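(* For each integer $n\ge 1$, let $\xi_n'$ be the number of block pairs of a uniformly random $B_n$-partition without zero-block. Then the limiting distribution of $\xi_n'$ is normal; that is, the random variable $$\frac{\xi_n'-\mathrm{E}(\xi_n')}{\sqrt{\mathrm{V}(\xi_n')}}$$ (defined for all sufficiently large $n$) converges in distribution to the standard normal distribution as $n\to\infty$, where $\mathrm{E}(\xi_n')$ and $\mathrm{V}(\xi_n')$ denote the expectation and the variance of $\xi_n'$.
   Context: A type $B_n$ set partition ($B_n$-partition) is a partition $\pi$ of the set $\{1,2,\ldots,n,-1,-2,\ldots,-n\}$ into nonempty blocks such that for any block $B$ of $\pi$, the set $-B=\{-b: b\in B\}$ is also a block of $\pi$, and there is at most one block, called the zero-block, satisfying $B=-B$. If $B$ is a block that is not a zero-block, then the (unordered) pair $(B,-B)$ is called a block pair of $\pi$. A $B_n$-partition is without zero-block if no block satisfies $B=-B$. *)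

(* Defs.v *)
(* The analysis library is imported after the combinatorial definitions, which use
   the finite-set reading of [set x in A | P]. *)
From HB Require Import structures.
From mathcomp Require Import all_boot all_order all_algebra.

Set Implicit Arguments.
Unset Strict Implicit.
Unset Printing Implicit Defensive.

Import Order.TTheory GRing.Theory Num.Theory.

(* The ground set {1, ..., n, -1, ..., -n}: (i, false) stands for i + 1 and
   (i, true) for -(i + 1). *)
Definition signed (n : nat) : finType := ('I_n * bool)%type.

Definition sopp n (x : signed n) : signed n := (x.1, ~~ x.2).

Definition opp_block n (B : {set signed n}) : {set signed n} := sopp (n:=n) @: B.

Definition self_opp n (B : {set signed n}) : bool := opp_block B == B.

Definition is_B_partition n (P : {set {set signed n}}) : bool :=
  [&& partition P [set: signed n],
      [forall B in P, opp_block B \in P] &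
      #|[set B in P | self_opp B]| <= 1].

Definition without_zero_block n (P : {set {set signed n}}) : bool :=
  [forall B in P, ~~ self_opp B].

Definition block_pairs n (P : {set {set signed n}}) : {set {set {set signed n}}} :=
  [set [set B; opp_block B] | B in P & ~~ self_opp B].

Definition B0_partition (n : nat) : Type :=
  {P : {set {set signed n}} | is_B_partition P && without_zero_block P}.

HB.instance Definition _ n := Finite.on (B0_partition n).

Definition discrete_partition n : {set {set signed n}} :=
  [set [set x] | x : signed n].

Lemma opp_block1 n (x : signed n) : opp_block [set x] = [set sopp x].
Proof. exact: imset_set1. Qed.

Lemma discrete_partition_B0 n :
  is_B_partition (discrete_partition n) &&
  without_zero_block (discrete_partition n).
Proof.
have nz (x : signed n) : ~~ self_opp [set x].
  rewrite /self_opp opp_block1; apply/eqP => /set1_inj.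
  by case: x => i [].
apply/andP; split; last by apply/forall_inP => _ /imsetP[x _ ->].
apply/and3P; split.
- apply/and3P; split.
  + rewrite eqEsubset subsetT; apply/subsetP => x _.
    by apply/bigcupP; exists [set x]; rewrite ?set11 ?imset_f.
  + apply/trivIsetP => _ _ /imsetP[x _ ->] /imsetP[y _ ->] xy.
    by rewrite disjoints1 inE; apply: contra xy => /eqP ->.
  + by apply/imsetP => -[x _ /setP/(_ x)]; rewrite !inE eqxx.
- by apply/forall_inP => _ /imsetP[x _ ->]; rewrite opp_block1 imset_f.
- rewrite (_ : [set B in _ | _] = set0) ?cards0//.
  apply/setP => B; rewrite !inE; apply/negP => /andP[/imsetP[x _ ->]].
  by rewrite (negbTE (nz x)).
Qed.

From mathcomp Require Import finmap.
From mathcomp Require Import all_classical all_reals all_analysis measurable_realfun.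
Import numFieldNormedType.Exports.

HB.instance Definition _ n := isPointed.Build (B0_partition n)
  (Sub (discrete_partition n) (discrete_partition_B0 n)).

HB.instance Definition _ n := @isMeasurable.Build default_measure_display
  (B0_partition n) discrete_measurable discrete_measurable0
  discrete_measurableC discrete_measurableU.

Local Open Scope classical_set_scope.
Local Open Scope ring_scope.

(* The second argument of mnormalize is the value used when the total mass is 0
   or infinite; it is irrelevant here, see unif_B0E. *)
Definition unif_B0 (R : realType) (n : nat) : probability (B0_partition n) R :=
  mnormalize (@counting (B0_partition n) R) \d_point.

Lemma mnormalizeE d (T : measurableType d) (R : realType)
    (mu : {measure set T -> \bar R}) (P : probability T R) (a b : R) A :
  mu setT = a%:E -> a != 0 -> mu A = b%:E -> mnormalize mu P A = (b / a)%:E.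
Proof. by move=> mT a0 mA; rewrite /mnormalize mT/= eqe (negbTE a0)/= mA. Qed.

Lemma unif_B0E (R : realType) n (A : set (B0_partition n)) :
  unif_B0 R n A =
  (#|[set p | p \in A]%SET|%:R / #|{: B0_partition n}|%:R)%:E.
Proof.
have cE (B : set (B0_partition n)) :
    counting B = #|[set p | p \in B]%SET|%:R%:E :> \bar R.
  rewrite /counting asboolT; last exact: finite_finset.
  rewrite -card_finset; congr (#|` _|%:R%:E); apply/fsetP => p.
  rewrite in_fset_set; last exact: finite_finset.
  apply/idP/imfsetP => [pB|[q /=]]; first by exists p; rewrite ?finset.in_set.
  by rewrite finset.in_set => qB ->.
have T0 : #|{: B0_partition n}|%:R != 0 :> R.
  by rewrite pnatr_eq0 -lt0n; apply/card_gt0P; exists point.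
have cT : counting [set: B0_partition n] = #|{: B0_partition n}|%:R%:E :> \bar R.
  rewrite cE; congr EFin; congr (_%:R); apply: eq_card => p.
  by rewrite finset.in_set in_setT.
exact: (mnormalizeE _ (cT : _ setT = _) T0 (cE A : _ A = _)).
Qed.

Definition nb_block_pairs (R : realType) n (p : B0_partition n) : R :=
  #|block_pairs (val p)|%:R.

Lemma measurable_B0 (R : realType) n (f : B0_partition n -> R) :
  measurable_fun setT f.
Proof. by []. Qed.

HB.instance Definition _ (R : realType) n :=
  isMeasurableFun.Build _ _ _ _ (@nb_block_pairs R n)
    (measurable_B0 (@nb_block_pairs R n)).

Definition xi' (R : realType) (n : nat) : {RV (unif_B0 R n) >-> R} :=
  @nb_block_pairs R n.

Definition standardize d (T : measurableType d) (R : realType)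
    (P : probability T R) (X : {RV P >-> R}) : T -> R :=
  fun t => (X t - fine 'E_P[X]) / Num.sqrt (fine 'V_P[X]).

Lemma measurable_standardize d (T : measurableType d) (R : realType)
    (P : probability T R) (X : {RV P >-> R}) :
  measurable_fun setT (standardize X).
Proof.
by apply: measurable_funM => //; apply: measurable_funB.
Qed.

HB.instance Definition _ d (T : measurableType d) (R : realType)
    (P : probability T R) (X : {RV P >-> R}) :=
  isMeasurableFun.Build _ _ _ _ (standardize X) (measurable_standardize X).

Definition cvg_in_distribution (R : realType) (d : nat -> measure_display)
    (T : forall n, measurableType (d n)) (P : forall n, probability (T n) R)
    (X : forall n, {RV (P n) >-> R}) (mu : probability (measurableTypeR R) R) : Prop :=
  forall x : R, {for x, continuous (fun t : R => mu `]-oo, t]%classic)} ->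
    cdf (X n) x @[n --> \oo] --> mu `]-oo, x]%classic.

(* Main.v *)
From HB Require Import structures.
Require Import Defs.
From mathcomp Require Import all_boot all_order all_algebra.
From mathcomp Require Import ring lra zify complex.
Import Order.TTheory GRing.Theory Num.Theory.

(** Inserting n + 1 and -(n + 1) into a partition without zero-block either
    creates a new block pair, in one way, or adds n + 1 to one of the 2k existing
    blocks and -(n + 1) to the opposite one.  Hence the number of partitions of {1, ..., n, -1, ..., -n} with k
    block pairs is 2^(n - k) S(n, k), and the number of block pairs has weights
    proportional to S(n, k) x^k with x = 1/2.  The generating polynomials are
    the Touchard polynomials T_n, given by T_(n+1) = X (T_n + T_n').

    Adding its derivative to a real-rooted polynomial keeps it real-rooted
    ([real_rooted_add_deriv]), so T_n has only real roots, none positive, and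
    the number of block pairs is distributed as a sum of independent Bernoulli
    variables ([stirling_sum_pb]).  Such sums are asymptotically normal as soon
    as their variance tends to infinity ([pb_clt]).  This is proved by Stein's
    method: a Bernoulli sum satisfies E[(K - mu) g(K)] = sigma^2 E[g'(K)] up to
    sigma^2 times a Lipschitz constant of g' ([pb_stein]), while Stein's
    equation f' - w f = h - E h(N), for a piecewise linear h that approximates
    the indicator of a half-line, has a solution with Lipschitz derivative
    ([stein_equation], through the Mills ratio bounds).

    It remains to see that the variance is unbounded ([spread_unbounded]).  Write
    phi_n = T_n(x), r_n = phi_(n+1) / phi_n and v_n = r_n (r_(n+1) - r_n).  The
    mean and the variance of the weights S(n, k) x^k are r_n - x and v_n - x.
    The Bernoulli structure gives v_n <= r_n, and, by bounding the third
    cumulant from below, v_(n+1) >= v_n - 2: the variance cannot collapse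
    suddenly.  Let w_j = x C(n, j) phi_(n-j), the total weight of the partitions
    of n + 1 points in which one given point shares its block with j others.
    Then sum_j w_j = phi_(n+1), sum_j j w_j = n phi_n, and
      phi_n (r_n - v_n) = sum_j w_j (r_n - r_(n-j)).
    A small v_n keeps every nearby v_m small, hence r_n - r_(n-j) small for
    the relevant j, and the identity then makes r_n - v_n small, which is
    absurd since r_n is large.  Quantitatively v_n is at least of order
    r_n^2 / n, and the crude bound S(n, m) >= m^(n - m) with m = n/4 gives
    r_n >= c n^(3/4). *)

Set Implicit Arguments.
Unset Strict Implicit.
Unset Printing Implicit Defensive.

(** * Partitions stable under an involution, without stable blocks *)

Section SignedPartitions.
Variables (T : finType) (opp : T -> T).
Hypothesis oppK : involutive opp.
Implicit Types (A B C D : {set T}) (P Q : {set {set T}}).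

Local Notation N B := (opp @: B).

Definition signed_partition A P :=
  partition P A && [forall B in P, (N B \in P) && (N B != B)].

Lemma mem_opp B x : (x \in N B) = (opp x \in B).
Proof.
apply/imsetP/idP => [[y yB ->]|xB]; first by rewrite oppK.
by exists (opp x); rewrite ?oppK.
Qed.

Lemma opp_setK : involutive (fun B => N B).
Proof. by move=> B; apply/setP => x; rewrite !mem_opp oppK. Qed.

Lemma opp_setU1 x B : N (x |: B) = opp x |: N B.
Proof. by rewrite imsetU1. Qed.

(** The elementwise form avoids [trivIset] and [cover] in the bijection below. *)
Lemma signed_partitionP A P :
  reflect [/\ set0 \notin P, forall D, D \in P -> D \subset A,
              forall x, x \in A -> exists2 D, D \in P & x \in D,
              forall D E x, D \in P -> E \in P -> x \in D -> x \in E -> D = E &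
              forall D, D \in P -> N D \in P /\ N D != D]
          (signed_partition A P).
Proof.
apply: (iffP andP) => [[/and3P[/eqP covP trivP P0] /forall_inP symP]|].
  split=> //.
  - by move=> D DP; rewrite -covP; apply: bigcup_sup.
  - by move=> x; rewrite -covP => /bigcupP[D DP xD]; exists D.
  - move=> D E x DP EP xD xE.
    by rewrite -(def_pblock trivP DP xD) (def_pblock trivP EP xE).
  - by move=> D /symP/andP.
move=> [P0 subP covP trivP symP]; split; last first.
  by apply/forall_inP => D /symP[-> ->].
apply/and3P; split=> //.
- rewrite eqEsubset; apply/andP; split; first exact/bigcupsP.
  by apply/subsetP => x /covP[D DP xD]; apply/bigcupP; exists D.
- apply/trivIsetP => D E DP EP; apply: contraR => /pred0Pn[x /andP[xD xE]].
  exact/eqP/(trivP _ _ x).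
Qed.

Section Extension.
Variables (A : {set T}) (t : T).
Hypotheses (oppA : N A = A) (tA : t \notin A) (tt : opp t != t).

(** Taking the second component empty creates the new blocks {t} and {opp t}, so
    that both ways of inserting t are given by the same formula. *)
Definition insert_pair (PB : {set {set T}} * {set T}) : {set {set T}} :=
  (t |: PB.2) |: ((opp t |: N PB.2) |: (PB.1 :\ PB.2 :\ N PB.2)).

(** The second component remembers which block contained t; it is empty exactly
    when t was alone. *)
Definition remove_pair P : {set {set T}} * {set T} :=
  ([set D :\: [set t; opp t] | D in P] :\ set0, pblock P t :\ t).

Let otA : opp t \notin A. Proof. by rewrite -oppA mem_opp oppK. Qed.

Lemma insert_pairP P B D : reflect
  [\/ D = t |: B, D = opp t |: N B | [/\ D != N B, D != B & D \in P]]
  (D \in insert_pair (P, B)).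
Proof.
rewrite !inE /=; apply: (iffP or3P) => -[/eqP->|/eqP->|/and3P H];
  by [constructor 1|constructor 2|constructor 3].
Qed.

Section Insert.
Variables (P : {set {set T}}) (B : {set T}).
Hypotheses (PA : signed_partition A P) (BP : B \in set0 |: P).

Let oppBP : N B \in set0 |: P.
Proof.
have [_ _ _ _ symP] := signed_partitionP _ _ PA.
case/setU1P: BP => [->|/symP[H _]]; first by rewrite imset0 setU11.
by rewrite inE H orbT.
Qed.

Let subB : B \subset A.
Proof.
have [_ subP _ _ _] := signed_partitionP _ _ PA.
by case/setU1P: BP => [->|/subP//]; exact: sub0set.
Qed.

Let suboB : N B \subset A.
Proof. by rewrite -oppA; apply: imsetS. Qed.

Let disjB x : x \in B -> x \in N B -> False.
Proof.
have [_ _ _ trivP symP] := signed_partitionP _ _ PA.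
case/setU1P: BP => [->|BP']; first by rewrite inE.
have [oBP /eqP noB] := symP _ BP'.
by move=> xB xoB; apply: noB; apply: (trivP _ _ x).
Qed.

Let tB : t \notin B. Proof. exact: contra (subsetP subB _) tA. Qed.
Let otB : opp t \notin B. Proof. exact: contra (subsetP subB _) otA. Qed.
Let toB : t \notin N B. Proof. exact: contra (subsetP suboB _) tA. Qed.
Let otoB : opp t \notin N B. Proof. exact: contra (subsetP suboB _) otA. Qed.

(** With [insert_pairK], [remove_pair_signed] and [remove_pairK], this makes
    [insert_pair] a bijection from the pairs (P, B), with B a block of P or the empty
    set, onto the partitions of the larger ground set. *)
Lemma insert_pair_signed :
  signed_partition (t |: (opp t |: A)) (insert_pair (P, B)).
Proof.
have [P0 subP covP trivP symP] := signed_partitionP _ _ PA.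
have tD D : D \in P -> t \notin D by move/subP/subsetP/(_ t)/contra/(_ tA).
have otD D : D \in P -> opp t \notin D by move/subP/subsetP/(_ (opp t))/contra/(_ otA).
have triv1 D x : D \in P -> D != B -> x \in D -> x \in B -> False.
  move=> DP DB xD xB; case/setU1P: BP => [B0|BP']; first by rewrite B0 inE in xB.
  by case/eqP: DB; apply: trivP xD xB.
have triv2 D x : D \in P -> D != N B -> x \in D -> x \in N B -> False.
  move=> DP DB xD xB; case/setU1P: oppBP => [B0|BP']; first by rewrite B0 inE in xB.
  by case/eqP: DB; apply: trivP xD xB.
have oN : opp t |: N B = N (t |: B) by rewrite opp_setU1.
have Ct : N (t |: B) != t |: B.
  apply/eqP => /setP/(_ t); rewrite mem_opp !inE eqxx (negbTE tt) /=.
  by rewrite (negbTE otB).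
apply/signed_partitionP; split.
- apply/negP => /insert_pairP[/setP/(_ t)|/setP/(_ (opp t))|[_ _]]; last exact/negP.
  + by rewrite !inE eqxx.
  + by rewrite !inE eqxx.
- move=> D /insert_pairP[->|->|[_ _ /subP DA]].
  + by apply: setUS; apply: subset_trans subB (subsetUr _ _).
  + by rewrite setUA (setUC [set t]) -setUA; apply: setUS; apply: subset_trans suboB (subsetUr _ _).
  + by rewrite setUA; apply: subset_trans DA (subsetUr _ _).
- move=> x /setU1P[->|/setU1P[->|/covP[D DP xD]]].
  + by exists (t |: B); [apply/insert_pairP; constructor 1 | rewrite setU11].
  + by exists (opp t |: N B); [apply/insert_pairP; constructor 2 | rewrite setU11].
  + have [DoB|DnoB] := eqVneq D (N B).
      exists (opp t |: N B); first by apply/insert_pairP; constructor 2.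
      by rewrite -DoB inE xD orbT.
    have [DB|DnB] := eqVneq D B.
      exists (t |: B); first by apply/insert_pairP; constructor 1.
      by rewrite -DB inE xD orbT.
    by exists D => //; apply/insert_pairP; constructor 3.
- have sw D (E : {set T}) x : D \in insert_pair (P, B) -> x \in D -> x \in E ->
      [\/ E = t |: B, E = opp t |: N B | [/\ E != N B, E != B & E \in P]] ->
      [\/ D = E, (E = t |: B /\ (D = opp t |: N B)) | (E = opp t |: N B /\ D = t |: B)].
    move=> /insert_pairP[->|->|[DoB DB DP]] xD xE [EE|EE|[EoB EB EP]];
      rewrite ?EE; try by [constructor 1|constructor 2|constructor 3].
    + move: xD; rewrite !inE => /orP[/eqP xt|xB].
        by move: xE; rewrite xt (negbTE (tD _ EP)).
      by case: (triv1 _ _ EP EB xE xB).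
    + move: xD; rewrite !inE => /orP[/eqP xt|xB].
        by move: xE; rewrite xt (negbTE (otD _ EP)).
      by case: (triv2 _ _ EP EoB xE xB).
    + move: xE; rewrite EE !inE => /orP[/eqP xt|xB].
        by move: xD; rewrite xt (negbTE (tD _ DP)).
      by case: (triv1 _ _ DP DB xD xB).
    + move: xE; rewrite EE !inE => /orP[/eqP xt|xB].
        by move: xD; rewrite xt (negbTE (otD _ DP)).
      by case: (triv2 _ _ DP DoB xD xB).
    + by constructor 1; apply: trivP xD xE.
  have dis x : x \in t |: B -> x \in opp t |: N B -> False.
    rewrite !inE => /orP[/eqP->|xB] /orP[/eqP|xoB].
    + by move=> /esym/eqP; rewrite (negbTE tt).
    + by rewrite (negbTE toB) in xoB.
    + by move=> xt; rewrite xt (negbTE otB) in xB.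
    + exact: disjB xB xoB.
  move=> D E x DP /insert_pairP EP xD xE.
  case: (sw D E x DP xD xE EP) => // -[EE DD].
  + by rewrite EE in xE; rewrite DD in xD; case: (dis x).
  + by rewrite EE in xE; rewrite DD in xD; case: (dis x).
- move=> D /insert_pairP[->|->|[DoB DB DP]].
  + split; last exact: Ct.
    by apply/insert_pairP; constructor 2; rewrite oN.
  + rewrite oN opp_setK eq_sym; split; last exact: Ct.
    by apply/insert_pairP; constructor 1.
  + have [oDP oD] := symP _ DP; split=> //.
    apply/insert_pairP; constructor 3; split=> //.
    * by apply: contra_neq DB => /(congr1 (fun X : {set T} => N X)); rewrite !opp_setK.
    * by apply: contra_neq DoB => <-; rewrite opp_setK.
Qed.

Lemma insert_pairK : remove_pair (insert_pair (P, B)) = (P, B).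
Proof.
have [P0 subP covP trivP symP] := signed_partitionP _ _ PA.
have /andP[/and3P[_ triv' _] _] := insert_pair_signed.
rewrite /remove_pair (def_pblock triv' (B := t |: B)); last 2 first.
- by apply/insert_pairP; constructor 1.
- exact: setU11.
rewrite setU1K//; congr pair.
have DS D : D \subset A -> D :\: [set t; opp t] = D.
  move=> DA; apply/setP => x; rewrite !inE; case xD: (x \in D); rewrite ?andbF//.
  rewrite andbT; have xA := subsetP DA x xD.
  by apply/negP => /orP[] /eqP xt; move: xA; rewrite xt ?(negbTE tA) ?(negbTE otA).
have CS : (t |: B) :\: [set t; opp t] = B.
  rewrite setDUl (DS _ subB); apply/setUidPr/subsetP => x.
  by rewrite !inE => /andP[/norP[/negbTE->]].
have oCS : (opp t |: N B) :\: [set t; opp t] = N B.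
  rewrite setDUl (DS _ suboB); apply/setUidPr/subsetP => x.
  by rewrite !inE => /andP[/norP[_ /negbTE->]].
apply/setP => D; apply/setD1P/idP => [[D0 /imsetP[E]]|DP].
  move=> /insert_pairP[->|->|[_ _ EP]].
  + by rewrite CS => DE; case/setU1P: BP => [B0|]; [rewrite DE B0 eqxx in D0|rewrite DE].
  + by rewrite oCS => DE; case/setU1P: oppBP => [B0|]; [rewrite DE B0 eqxx in D0|rewrite DE].
  + by rewrite DS ?subP// => ->.
split; first by apply: contraNneq P0 => <-.
apply/imsetP; have [DB|DnB] := eqVneq D B.
  by exists (t |: B); [apply/insert_pairP; constructor 1 | rewrite CS].
have [DB|DnoB] := eqVneq D (N B).
  by exists (opp t |: N B); [apply/insert_pairP; constructor 2 | rewrite oCS].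
by exists D; [apply/insert_pairP; constructor 3 | rewrite DS ?subP].
Qed.

Lemma card_insert_pair :
  #|insert_pair (P, B)| = (if B == set0 then #|P|.+2 else #|P|).
Proof.
have [P0 subP covP trivP symP] := signed_partitionP _ _ PA.
have tD D : D \in P -> t \notin D by move/subP/subsetP/(_ t)/contra/(_ tA).
have otD D : D \in P -> opp t \notin D by move/subP/subsetP/(_ (opp t))/contra/(_ otA).
have nC1 : t |: B \notin (opp t |: N B) |: (P :\ B :\ N B).
  rewrite !inE; apply/norP; split.
    apply/eqP => /setP/(_ t); rewrite !inE eqxx (negbTE toB) orbF /=.
    by rewrite eq_sym (negbTE tt).
  by apply/negP => /and3P[_ _ /tD]; rewrite !inE eqxx.
have nC2 : opp t |: N B \notin P :\ B :\ N B.
  by rewrite !inE; apply/negP => /and3P[_ _ /otD]; rewrite !inE eqxx.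
rewrite /insert_pair cardsU1 nC1 cardsU1 nC2 /=.
case: eqP BP => [->|/eqP Bn0] BP'.
  rewrite imset0 -[in RHS](_ : P :\ set0 :\ set0 = P) ?add1n//.
  apply/setP => D; rewrite !inE; have [->|] //= := eqVneq D set0.
  by rewrite (negbTE P0).
case/setU1P: BP' => [/eqP|BP']; first by rewrite (negbTE Bn0).
have [oBP oB] := symP _ BP'.
by rewrite (cardsD1 B P) BP' (cardsD1 (N B) (P :\ B)) !inE oB oBP.
Qed.

End Insert.

Section Remove.
Variable P : {set {set T}}.
Hypothesis PA : signed_partition (t |: (opp t |: A)) P.

Let S : {set T} := [set t; opp t].
Let C := pblock P t.

Let CP : C \in P.
Proof. by have /andP[/and3P[/eqP c _ _] _] := PA; apply: pblock_mem; rewrite c setU11. Qed.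

Let tC : t \in C.
Proof. by have /andP[/and3P[/eqP c _ _] _] := PA; rewrite mem_pblock c setU11. Qed.

Let otC : opp t \notin C.
Proof.
have [P0 subP covP trivP symP] := signed_partitionP _ _ PA.
have [oCP /eqP oC] := symP _ CP.
apply/negP => h; apply: oC; apply: (trivP _ _ t) => //.
by rewrite mem_opp.
Qed.

Let CS : C :\ t = C :\: S.
Proof.
apply/setP => x; rewrite !inE; have [->|_] //= := eqVneq x t.
by case: eqP => //= ->; rewrite (negbTE otC).
Qed.

Let oppS D : N (D :\: S) = N D :\: S.
Proof.
apply/setP => x; rewrite mem_opp !inE !mem_opp (inj_eq (inv_inj oppK)).
by rewrite (can2_eq oppK oppK) orbC.
Qed.

Lemma remove_pair_signed :
  signed_partition A (remove_pair P).1 && ((remove_pair P).2 \in set0 |: (remove_pair P).1).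
Proof.
have [P0 subP covP trivP symP] := signed_partitionP _ _ PA.
apply/andP; split; last first.
  rewrite /= -/C CS !inE; case: eqP => //= _.
  by apply/imsetP; exists C.
rewrite /=; apply/signed_partitionP; split.
- by rewrite !inE eqxx.
- move=> _ /setD1P[_ /imsetP[D DP ->]]; apply/subsetP => x.
  rewrite !inE => /andP[/norP[xt xot] /(subsetP (subP _ DP))].
  by rewrite !inE (negbTE xt) (negbTE xot).
- move=> x xA; have [|D DP xD] := covP x; first by rewrite !inE xA !orbT.
  have xDS : x \in D :\: S.
    rewrite !inE xD andbT; apply/norP.
    by split; apply: contraTneq xA => ->.
  exists (D :\: S) => //; rewrite in_setD1; apply/andP; split.
    by apply: contraTneq xDS => ->; rewrite inE.
  by apply/imsetP; exists D.
- move=> _ _ x /setD1P[_ /imsetP[D DP ->]] /setD1P[_ /imsetP[E EP ->]].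
  by rewrite !in_setD => /andP[_ xD] /andP[_ xE]; rewrite (trivP D E x).
- move=> E /setD1P[D0 /imsetP[D DP DE]]; rewrite DE in D0 *.
  have [oDP oD] := symP _ DP.
  rewrite oppS; split.
    rewrite in_setD1; apply/andP; split; last by apply/imsetP; exists (N D).
    apply: contra_neq D0 => /(congr1 (fun X : {set T} => N X)).
    by rewrite -oppS opp_setK imset0.
  apply: contraNneq oD => oD; have /set0Pn[x xD] := D0.
  have xoD : x \in N D :\: S by rewrite oD.
  by apply/eqP; apply: (trivP _ _ x) => //; [case/setDP: xoD|case/setDP: xD].
Qed.

Lemma remove_pairK : insert_pair (remove_pair P) = P.
Proof.
have [P0 subP covP trivP symP] := signed_partitionP _ _ PA.
have [oCP oC] := symP _ CP.
have e1 : t |: (C :\ t) = C by rewrite setD1K.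
have e2 : opp t |: N (C :\ t) = N C by rewrite -opp_setU1 e1.
have otoC : opp t \in N C by rewrite mem_opp oppK.
have DS D : D \in P -> D <> C -> D <> N C -> D :\: S = D.
  move=> DP DC DoC; apply/setP => x; rewrite !inE.
  case xD: (x \in D); rewrite ?andbF// andbT.
  apply/negP => /orP[] /eqP xt; rewrite xt in xD.
    by apply: DC; apply: trivP xD tC.
  by apply: DoC; apply: trivP xD otoC.
apply/setP => X; apply/insert_pairP/idP; rewrite -/C.
  rewrite e1 e2; move=> [->|->|[XoC XC /setD1P[X0 /imsetP[D DP XD]]]] //.
  rewrite -/S in XD; rewrite XD DS//.
    by move=> DC; rewrite XD DC CS eqxx in XC.
  by move=> DC; rewrite XD DC CS oppS eqxx in XoC.
move=> XP; rewrite e1 e2.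
have [->|/eqP XC] := eqVneq X C; first by constructor 1.
have [->|/eqP XoC] := eqVneq X (N C); first by constructor 2.
have XS := DS _ XP XC XoC.
have X0 : X != set0 by apply: contraNneq P0 => <-.
constructor 3; split.
- apply/eqP => XE; apply: XoC; have /set0Pn[x xX] := X0.
  apply: (trivP _ _ x) => //.
  by move: xX; rewrite XE CS oppS => /setDP[].
- apply/eqP => XE; apply: XC; have /set0Pn[x xX] := X0.
  apply: (trivP _ _ x) => //.
  by move: xX; rewrite XE CS => /setDP[].
- by rewrite in_setD1 X0; apply/imsetP; exists X.
Qed.

End Remove.

(** The block that receives t is one of the #|P| blocks of P, or a new one, in
    which case the pair of blocks {t}, {opp t} is added. *)
Lemma sum_signed_partition_insert (R : nmodType) (f : nat -> R) :
  (\sum_(P | signed_partition (t |: (opp t |: A)) P) f #|P| =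
   \sum_(P | signed_partition A P) (f #|P| *+ #|P| + f #|P|.+2))%R.
Proof.
rewrite (reindex_onto insert_pair remove_pair) /=; last first.
  by move=> P PA; exact: remove_pairK.
rewrite (eq_bigl (fun PB => signed_partition A PB.1 && (PB.2 \in set0 |: PB.1))); last first.
  move=> [P B] /=; apply/andP/andP => [[iP /eqP rP]|[PA BP]].
    by have := remove_pair_signed iP; rewrite rP => /andP.
  by rewrite insert_pairK// insert_pair_signed.
rewrite -(pair_big_dep _ (fun P B => B \in set0 |: P) (fun P B => f #|insert_pair (P, B)|)) /=.
apply: eq_bigr => P PA.
have P0 : set0 \notin P by case/signed_partitionP: PA.
rewrite big_setU1//= card_insert_pair ?setU11// eqxx GRing.addrC; congr GRing.add.
rewrite -GRing.sumr_const; apply: eq_bigr => B BP.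
rewrite card_insert_pair//; last by rewrite inE BP orbT.
by rewrite ifN//; apply: contraNneq P0 => <-.
Qed.

End Extension.
End SignedPartitions.

Local Open Scope ring_scope.

(** * Adding its derivative to a real-rooted polynomial *)

Section RealRoots.
Variable R : rcfType.
Implicit Types (p : {poly R}) (s : seq R).

(** The inverse of z - a has the argument of the conjugate of z - a. *)
Lemma Im_inv_sub_real (z : R[i]) (a : R) : complex.Im z != 0 ->
  complex.Im (z - a%:C%C)^-1 * complex.Im z < 0.
Proof.
case: z => x y /= y0; have h : 0 < (x - a) ^+ 2 + y ^+ 2.
  by rewrite ltr_wpDl ?sqr_ge0// exprn_even_gt0.
rewrite oppr0 addr0 mulNr oppr_lt0 mulrAC divr_gt0//.
by rewrite -expr2 exprn_even_gt0.
Qed.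

Lemma sub_real_neq0 (z : R[i]) (a : R) : complex.Im z != 0 -> z - a%:C%C != 0.
Proof.
by apply: contra_neq => /eqP; rewrite subr_eq0 => /eqP ->.
Qed.

Lemma Im_sum_inv_sub_real (z : R[i]) s : complex.Im z != 0 -> s != [::] ->
  complex.Im (\sum_(a <- s) (z - a%:C%C)^-1) * complex.Im z < 0.
Proof.
move=> z0; elim: s => // a s IHs _; rewrite big_cons.
have ImD (u v : R[i]) : complex.Im (u + v) = complex.Im u + complex.Im v by case: u v => ? ? [].
rewrite ImD mulrDl.
have [->|s0] := eqVneq s [::]; first by rewrite big_nil /= mul0r addr0 Im_inv_sub_real.
by rewrite (lt_trans _ (Im_inv_sub_real a z0))// gtrDl IHs.
Qed.

Lemma horner_deriv_prod_XsubC (F : fieldType) (z : F) (s : seq F) :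
  (forall a, a \in s -> z - a != 0) ->
  (\prod_(a <- s) ('X - a%:P))^`().[z] =
  (\prod_(a <- s) ('X - a%:P)).[z] * \sum_(a <- s) (z - a)^-1.
Proof.
elim: s => [|a s IHs] h; first by rewrite !big_nil derivC horner0 mulr0.
rewrite !big_cons derivM !hornerE derivXsubC !hornerE IHs; last first.
  by move=> b bs; apply: h; rewrite inE bs orbT.
have ha : z - a != 0 by apply: h; rewrite mem_head.
by field.
Qed.

(** If z is a root of p + p' and not of p, then the logarithmic derivative
    sum_a 1 / (z - a) of p at z equals -1, hence is real; for z not real its imaginary part
    has the strict sign opposite to that of Im z.  So all complex roots are real. *)
Lemma real_rooted_add_deriv s : exists t : seq R,
  \prod_(a <- s) ('X - a%:P) + (\prod_(a <- s) ('X - a%:P))^`() =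
  \prod_(a <- t) ('X - a%:P).
Proof.
set p := \prod_(a <- s) _; set q := p + _.
have pm : p \is monic by apply: monic_prod_XsubC.
have szp : (size p^`() < size p)%N by apply: lt_size_deriv; apply: monic_neq0.
have qm : q \is monic by rewrite monicE lead_coefDl.
pose f := real_complex R.
have [r Er] := closed_field_poly_normal (map_poly f q).
rewrite lead_coef_map (monicP qm) rmorph1 scale1r in Er.
have realr z : z \in r -> z = f (complex.Re z).
  move=> zr; case: (eqVneq (complex.Im z) 0) => [|z0].
    by case: z {zr} => x y /= ->.
  have : root (map_poly f q) z by rewrite Er root_prod_XsubC.
  rewrite /root /q raddfD /= -deriv_map hornerD /p rmorph_prod /=.
  rewrite (eq_bigr (fun a => 'X - (f a)%:P)); last first.
    by move=> a _; rewrite rmorphB /= map_polyX map_polyC.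
  rewrite -(big_map f xpredT (fun a => 'X - a%:P)) horner_deriv_prod_XsubC; last first.
    by move=> _ /mapP[a _ ->]; exact: sub_real_neq0.
  rewrite -[X in X + _]mulr1 -mulrDr mulf_eq0 => /orP[|].
    rewrite -/(root _ z) root_prod_XsubC => /mapP[a _ za].
    by rewrite za /= eqxx in z0.
  rewrite big_map addrC addr_eq0 => /eqP e.
  have [s0|s0] := eqVneq s [::].
    by move: e => /eqP; rewrite s0 big_nil eq_sym oppr_eq0 oner_eq0.
  have := Im_sum_inv_sub_real z0 s0.
  by rewrite /f /= in e *; rewrite e /= oppr0 mul0r ltxx.
exists (map (@complex.Re R) r).
apply: (map_poly_inj f); rewrite Er rmorph_prod big_map /=.
rewrite big_seq [RHS]big_seq; apply: eq_bigr => z zr.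
by rewrite rmorphB /= map_polyX map_polyC /= {1}(realr z zr).
Qed.

End RealRoots.

(** * Sums of independent Bernoulli variables *)

Section PoissonBinomial.
Variable R : realFieldType.
Implicit Types (p c : R) (ps : seq R) (f g : nat -> R).

(** The expectation of f (X_1 + ... + X_m) for independent Bernoulli variables X_i
    with the parameters listed in ps, computed by conditioning on the first one. *)
Fixpoint pb_mean ps f : R :=
  if ps is p :: ps' then
    p * pb_mean ps' (fun k => f k.+1) + (1 - p) * pb_mean ps' f
  else f 0%N.

Definition is_proba p := 0 <= p <= 1.

Lemma eq_pb_mean ps f g : f =1 g -> pb_mean ps f = pb_mean ps g.
Proof.
elim: ps f g => [|p ps IHs] f g fg /=; first exact: fg.
by congr (_ * _ + _ * _); apply: IHs => k; apply: fg.
Qed.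

Lemma pb_mean_lin ps c d f g :
  pb_mean ps (fun k => c * f k + d * g k) = c * pb_mean ps f + d * pb_mean ps g.
Proof.
elim: ps f g => [|p ps IHs] f g //=.
rewrite (IHs (fun k => f k.+1) (fun k => g k.+1)) IHs; ring.
Qed.

Lemma pb_meanD ps f g :
  pb_mean ps (fun k => f k + g k) = pb_mean ps f + pb_mean ps g.
Proof.
rewrite -[in RHS](mul1r (pb_mean ps f)) -[in RHS](mul1r (pb_mean ps g)) -pb_mean_lin.
by apply: eq_pb_mean => k; rewrite !mul1r.
Qed.

Lemma pb_meanZ ps c f : pb_mean ps (fun k => c * f k) = c * pb_mean ps f.
Proof.
rewrite -[RHS]addr0 -(mul0r (pb_mean ps f)) -pb_mean_lin.
by apply: eq_pb_mean => k; rewrite mul0r addr0.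
Qed.

Lemma pb_mean_cst ps c : pb_mean ps (fun=> c) = c.
Proof. by elim: ps => //= p ps ->; rewrite -mulrDl addrC subrK mul1r. Qed.

Lemma pb_mean_le ps f g : all is_proba ps -> (forall k, f k <= g k) ->
  pb_mean ps f <= pb_mean ps g.
Proof.
elim: ps f g => [|p ps IHs] f g /=; first by move=> _; apply.
move=> /andP[/andP[p0 p1] hps] fg.
by apply: lerD; apply: ler_wpM2l; rewrite ?subr_ge0//; apply: IHs.
Qed.

Lemma pb_mean_norm ps f : all is_proba ps ->
  `|pb_mean ps f| <= pb_mean ps (fun k => `|f k|).
Proof.
elim: ps f => [|p ps IHs] f //= /andP[/andP[p0 p1] hps].
apply: (le_trans (ler_normD _ _)); rewrite !normrM (ger0_norm p0).
rewrite (@ger0_norm _ (1 - p)) ?subr_ge0//.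
by apply: lerD; apply: ler_wpM2l; rewrite ?subr_ge0//; apply: IHs.
Qed.

Definition pb_mu ps : R := \sum_(p <- ps) p.
Definition pb_var ps : R := \sum_(p <- ps) p * (1 - p).
(** The third cumulant, which adds over independent variables. *)
Definition pb_kappa3 ps : R := \sum_(p <- ps) p * (1 - p) * (1 - 2 * p).

Lemma pb_var_ge0 ps : all is_proba ps -> 0 <= pb_var ps.
Proof.
move=> /allP h; rewrite /pb_var big_seq; apply: sumr_ge0 => p /h /andP[p0 p1].
by rewrite mulr_ge0 ?subr_ge0.
Qed.

Lemma pb_var_le_mu ps : all is_proba ps -> pb_var ps <= pb_mu ps.
Proof.
move=> /allP h; rewrite /pb_var /pb_mu big_seq [leRHS]big_seq.
by apply: ler_sum => p /h /andP[p0 p1]; rewrite ler_piMr// gerBl.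
Qed.

Lemma pb_kappa3_ge ps : all is_proba ps -> - pb_var ps <= pb_kappa3 ps.
Proof.
move=> /allP h; rewrite /pb_var /pb_kappa3 -sumrN big_seq [leRHS]big_seq.
apply: ler_sum => p /h /andP[p0 p1]; rewrite lerNl -mulrN ler_piMr ?mulr_ge0 ?subr_ge0//.
by lra.
Qed.

Let u ps k : R := k%:R - pb_mu ps.

Lemma pb_mean_poly3 ps f (c0 c1 c2 c3 : R) :
  pb_mean ps (fun k => c0 + c1 * f k + c2 * f k ^+ 2 + c3 * f k ^+ 3) =
  c0 + c1 * pb_mean ps f + c2 * pb_mean ps (fun k => f k ^+ 2)
  + c3 * pb_mean ps (fun k => f k ^+ 3).
Proof. by rewrite 3!pb_meanD pb_mean_cst !pb_meanZ. Qed.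

(** The first three central moments coincide with the cumulants, which are
    additive; the induction conditions on the first variable. *)
Lemma pb_central_moments ps :
  [/\ pb_mean ps (u ps) = 0,
      pb_mean ps (fun k => u ps k ^+ 2) = pb_var ps &
      pb_mean ps (fun k => u ps k ^+ 3) = pb_kappa3 ps].
Proof.
elim: ps => [|p ps [IH1 IH2 IH3]].
  by rewrite /= /u /pb_mu /pb_var /pb_kappa3 !big_nil subr0 !expr0n.
have uS k : u (p :: ps) k.+1 = u ps k + (1 - p).
  by rewrite /u /pb_mu big_cons -natr1; ring.
have u0 k : u (p :: ps) k = u ps k + - p.
  by rewrite /u /pb_mu big_cons; ring.
have E c : pb_mean ps (fun k => (u ps k + c) ^+ 1) = c /\
   pb_mean ps (fun k => (u ps k + c) ^+ 2) = pb_var ps + c ^+ 2 /\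
   pb_mean ps (fun k => (u ps k + c) ^+ 3) = pb_kappa3 ps + 3 * c * pb_var ps + c ^+ 3.
  split; [|split].
  - transitivity (pb_mean ps (fun k => c + 1 * u ps k + 0 * u ps k ^+ 2 + 0 * u ps k ^+ 3)).
      by apply: eq_pb_mean => k; ring.
    by rewrite pb_mean_poly3 IH1; ring.
  - transitivity (pb_mean ps (fun k => c ^+ 2 + (2 * c) * u ps k + 1 * u ps k ^+ 2 + 0 * u ps k ^+ 3)).
      by apply: eq_pb_mean => k; ring.
    by rewrite pb_mean_poly3 IH1 IH2; ring.
  - transitivity (pb_mean ps (fun k => c ^+ 3 + (3 * c ^+ 2) * u ps k + (3 * c) * u ps k ^+ 2 + 1 * u ps k ^+ 3)).
      by apply: eq_pb_mean => k; ring.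
    by rewrite pb_mean_poly3 IH1 IH2 IH3; ring.
have [E1 [E2 E3]] := E (1 - p); have [F1 [F2 F3]] := E (- p).
have S j : pb_mean (p :: ps) (fun k => u (p :: ps) k ^+ j) =
  p * pb_mean ps (fun k => (u ps k + (1 - p)) ^+ j) +
  (1 - p) * pb_mean ps (fun k => (u ps k + - p) ^+ j).
  by rewrite /=; congr (_ * _ + _ * _); apply: eq_pb_mean => k; rewrite ?uS ?u0.
rewrite (S 2%N) (S 3%N) E2 E3 F2 F3 -(eq_pb_mean _ (fun k => expr1 _)) (S 1%N) E1 F1.
by rewrite /pb_var /pb_kappa3 !big_cons; split; ring.
Qed.

Lemma pb_mean_id ps : pb_mean ps (fun k => k%:R) = pb_mu ps.
Proof.
have [h _ _] := pb_central_moments ps.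
rewrite (_ : pb_mean _ _ = pb_mean ps (fun k => u ps k + pb_mu ps)); last first.
  by apply: eq_pb_mean => k; rewrite subrK.
by rewrite pb_meanD h pb_mean_cst add0r.
Qed.

Lemma pb_mean_variance ps :
  pb_mean ps (fun k => (k%:R - pb_mu ps) ^+ 2) = pb_var ps.
Proof. by case: (pb_central_moments ps). Qed.

End PoissonBinomial.

(** * Touchard polynomials *)

Section Touchard.
Variables (R : rcfType) (x : R).
Hypothesis x0 : 0 < x.

(** The coefficient of 'X^k is the Stirling number S(n, k). *)
Definition touchard n : {poly R} := iter n (fun p => 'X * (p + p^`())) 1.

Lemma coef_touchard_ge0 n k : 0 <= (touchard n)`_k.
Proof.
elim: n k => [|n IHn] k; first by rewrite /= coef1 ler0n.
rewrite /= coefXM; case: k => //= k.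
by rewrite coefD coef_deriv addr_ge0// mulrn_wge0.
Qed.

Lemma touchard_monic n : touchard n \is monic.
Proof.
elim: n => [|n IHn]; first exact: monic1.
rewrite /= monicMl ?monicX//= monicE lead_coefDl.
  by rewrite -monicE.
by apply: lt_size_deriv; apply: monic_neq0.
Qed.

Lemma touchard_real_rooted n : exists2 s : seq R,
  touchard n = \prod_(a <- s) ('X - a%:P) & all (fun a => a <= 0) s.
Proof.
have [s Es] : exists s : seq R, touchard n = \prod_(a <- s) ('X - a%:P).
  elim: n => [|n [s IHn]]; first by exists [::]; rewrite big_nil.
  have [t Et] := real_rooted_add_deriv s.
  by exists (0 :: t); rewrite /= IHn Et big_cons subr0.
exists s => //; apply/allP => a aS; rewrite leNgt; apply/negP => a0.
have : root (touchard n) a by rewrite Es root_prod_XsubC.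
rewrite /root => /eqP r0; have := ltxx (0 : R); rewrite -{2}r0 horner_coef.
have := touchard_monic n; rewrite monicE /lead_coef => /eqP lc.
have := monic_neq0 (touchard_monic n); rewrite -size_poly_gt0.
case: (size _) lc => // m /= lc _; rewrite big_ord_recr /= lc mul1r.
rewrite ltr_wpDl ?exprn_gt0//; apply: sumr_ge0 => i _.
by rewrite mulr_ge0 ?coef_touchard_ge0// exprn_ge0// ltW.
Qed.

(** The sum over k of S(n, k) x^k f(k).  The recursion is the transpose of
    S(n + 1, k) = k S(n, k) + S(n, k - 1), see [stirling_sum_touchard]. *)
Fixpoint stirling_sum n (f : nat -> R) : R :=
  if n is n'.+1 then stirling_sum n' (fun k => k%:R * f k + x * f k.+1) else f 0%N.

Let L (p : {poly R}) (f : nat -> R) := \sum_(k < size p) p`_k * x ^+ k * f k.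

Let L_wide m (p : {poly R}) f : (size p <= m)%N -> L p f = \sum_(k < m) p`_k * x ^+ k * f k.
Proof.
move=> pm; rewrite /L (big_ord_widen m (fun k => p`_k * x ^+ k * f k))//.
rewrite [RHS](bigID (fun k : 'I_m => (k < size p)%N)) /= [X in _ = _ + X]big1 ?addr0//.
by move=> k; rewrite -leqNgt => h; rewrite nth_default// !mul0r.
Qed.

(** The operator p -> X (p + p') on polynomials is dual to the operator
    f -> (k -> k f(k) + x f(k + 1)) on test functions. *)
Lemma stirling_sum_touchard n f :
  stirling_sum n f = \sum_(k < size (touchard n)) (touchard n)`_k * x ^+ k * f k.
Proof.
rewrite -/(L _ _); elim: n f => [|n IHn] f.
  by rewrite /= /L size_poly1 big_ord1 coef1 expr0 !mul1r.
rewrite /= IHn; set p := touchard n.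
have sp : (size p^`() <= size p)%N.
  by apply/ltnW/lt_size_deriv/monic_neq0/touchard_monic.
rewrite [RHS](@L_wide (size p).+1); last first.
  rewrite mulrC size_mulX; last first.
    have := touchard_monic n.+1; rewrite /= monicMl ?monicX// => /monic_neq0; exact.
  by rewrite ltnS (leq_trans (size_polyD _ _))// geq_max leqnn.
rewrite big_ord_recl coefXM /= !mul0r add0r.
under [RHS]eq_bigr do rewrite /bump /= add1n coefXM /= coefD coef_deriv 2!mulrDl.
rewrite big_split /=.
rewrite /L; under [LHS]eq_bigr do rewrite mulrDr; rewrite big_split /= addrC; congr (_ + _).
  by apply: eq_bigr => k _; rewrite exprS; ring.
rewrite -[RHS](_ : \sum_(k < (size p).+1) p`_k * x ^+ k * (k%:R * f k) = _).
  by rewrite big_ord_recr /= nth_default// !mul0r addr0.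
rewrite big_ord_recl mul0r mulr0 add0r; apply: eq_bigr => k _.
by rewrite lift0 -mulr_natl; ring.
Qed.

Let L_prod s f : all (fun a => a <= 0) s ->
  L (\prod_(a <- s) ('X - a%:P)) f =
  (\prod_(a <- s) (x - a)) * pb_mean (map (fun a => x / (x - a)) s) f.
Proof.
elim: s f => [|a s IHs] f /=.
  by move=> _; rewrite !big_nil /L size_poly1 big_ord1 coef1 expr0 !mul1r.
move=> /andP[a0 s0]; rewrite !big_cons; set p := \prod_(a <- s) _ in IHs *.
have xa : x - a != 0 by rewrite gt_eqF// subr_gt0 (le_lt_trans a0).
have Lsplit : L (('X - a%:P) * p) f = x * L p (fun k => f k.+1) - a * L p f.
  rewrite (@L_wide (size p).+1); last first.
    apply: (leq_trans (size_polyMleq _ _)); rewrite size_XsubC addSn add1n.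
    by rewrite leqnn.
  rewrite /L.
  under eq_bigr do rewrite mulrBl coefB coefXM coefCM 2!mulrBl.
  rewrite sumrB; congr (_ - _).
    rewrite big_ord_recl /= !mul0r add0r mulr_sumr; apply: eq_bigr => k _.
    by rewrite /bump /= add1n exprS; ring.
  rewrite big_ord_recr /= nth_default// mulr0 !mul0r addr0 mulr_sumr.
  by apply: eq_bigr => k _; ring.
by rewrite Lsplit !IHs//; field.
Qed.

(** A monic factor X - a with a <= 0 contributes, after normalisation by its value
    x - a, a Bernoulli variable of parameter x / (x - a). *)
Lemma stirling_sum_pb n : exists2 ps : seq R, all (@is_proba R) ps &
  forall f, stirling_sum n f = stirling_sum n (fun=> 1) * pb_mean ps f.
Proof.
have [s Es s0] := touchard_real_rooted n.
exists (map (fun a => x / (x - a)) s).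
  apply/allP => _ /mapP[a /(allP s0) a0 ->]; rewrite /is_proba.
  have xa : 0 < x - a by rewrite subr_gt0 (le_lt_trans a0).
  by rewrite divr_ge0 ?(ltW x0) ?(ltW xa)//= ler_pdivrMr// mul1r lerDl oppr_ge0.
move=> f; rewrite !stirling_sum_touchard -/(L _ f) -/(L _ (fun=> 1)) Es !L_prod//.
by rewrite pb_mean_cst mulr1.
Qed.

Lemma eq_stirling_sum n f g : f =1 g -> stirling_sum n f = stirling_sum n g.
Proof.
elim: n f g => [|n IHn] f g fg /=; first exact: fg.
by apply: IHn => k; rewrite !fg.
Qed.

Lemma stirling_sumD n f g :
  stirling_sum n (fun k => f k + g k) = stirling_sum n f + stirling_sum n g.
Proof.
elim: n f g => [|n IHn] f g //=; rewrite -IHn.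
by apply: eq_stirling_sum => k; ring.
Qed.

Lemma stirling_sumZ n c f : stirling_sum n (fun k => c * f k) = c * stirling_sum n f.
Proof.
elim: n f => [|n IHn] f //=; rewrite -IHn.
by apply: eq_stirling_sum => k; ring.
Qed.

Lemma stirling_sum_ge0 n f : (forall k, 0 <= f k) -> 0 <= stirling_sum n f.
Proof.
elim: n f => [|n IHn] f f0 /=; first exact: f0.
by apply: IHn => k; rewrite addr_ge0// mulr_ge0// ltW.
Qed.

Definition touchard_value n := stirling_sum n (fun=> 1).
Local Notation phi := touchard_value.

Lemma phi_gt0 n : 0 < phi n.
Proof.
elim: n => [|n IHn]; first exact: ltr01.
rewrite /touchard_value /=; rewrite -[ltRHS](_ : stirling_sum n (fun k => k%:R) + x * phi n = _).
  by rewrite ltr_wpDl ?mulr_gt0//; apply: stirling_sum_ge0.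
by rewrite -stirling_sumZ -stirling_sumD; apply: eq_stirling_sum => k; rewrite !mulr1.
Qed.

Definition touchard_ratio n := phi n.+1 / phi n.
Local Notation ratio := touchard_ratio.

(** Up to the constant x, the variance of the weights S(n, k) x^k: see [ratio_pb].  It
    is also the variance of a Poisson variable N of parameter x reweighted by N^n. *)
Definition touchard_spread n := ratio n * (ratio n.+1 - ratio n).
Local Notation spread := touchard_spread.

Lemma ratio_gt0 n : 0 < ratio n.
Proof. by rewrite divr_gt0 ?phi_gt0. Qed.

(** Applying the recursion of [stirling_sum] once, twice and three times to the
    constant 1 expresses phi_(n+1), phi_(n+2) and phi_(n+3) through the first three moments
    at level n; this determines two consecutive spreads. *)
Lemma ratio_pb n : exists ps : seq R,
  [/\ all (@is_proba R) ps, forall f, stirling_sum n f = phi n * pb_mean ps f,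
      ratio n = pb_mu ps + x, spread n = pb_var ps + x &
      spread n.+1 = spread n + (pb_kappa3 ps + x) / ratio n - (spread n / ratio n) ^+ 2].
Proof.
have [ps hps E] := stirling_sum_pb n; exists ps.
have pn := phi_gt0 n; have pn1 := phi_gt0 n.+1; have pn2 := phi_gt0 n.+2.
have [c1 c2 c3] := pb_central_moments ps.
set mu := pb_mu ps in c1 c2 c3 *; set s := pb_var ps in c1 c2 c3 *.
set ka := pb_kappa3 ps in c1 c2 c3 *; set r := mu + x.
have P1 : phi n.+1 = phi n * r.
  rewrite {1}/touchard_value /= E; congr (_ * _).
  transitivity (pb_mean ps (fun k => r + 1 * (k%:R - mu) + 0 * (k%:R - mu) ^+ 2 + 0 * (k%:R - mu) ^+ 3)).
    by apply: eq_pb_mean => k; rewrite /r; ring.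
  by rewrite (pb_mean_poly3 ps (fun k => k%:R - mu)) c1; ring.
have P2 : phi n.+2 = phi n * (s + r ^+ 2 + x).
  rewrite {1}/touchard_value /= E; congr (_ * _).
  transitivity (pb_mean ps (fun k => (r ^+ 2 + x) + (2 * r) * (k%:R - mu) + 1 * (k%:R - mu) ^+ 2 + 0 * (k%:R - mu) ^+ 3)).
    by apply: eq_pb_mean => k; rewrite /r -natr1; ring.
  by rewrite (pb_mean_poly3 ps (fun k => k%:R - mu)) c1 c2; ring.
have P3 : phi n.+3 = phi n * (ka + 3 * r * s + r ^+ 3 + 3 * x * r + x).
  rewrite {1}/touchard_value /= E; congr (_ * _).
  transitivity (pb_mean ps (fun k => (r ^+ 3 + 3 * x * r + x) + (3 * r ^+ 2 + 3 * x) * (k%:R - mu) + (3 * r) * (k%:R - mu) ^+ 2 + 1 * (k%:R - mu) ^+ 3)).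
    by apply: eq_pb_mean => k; rewrite /r -!natr1; ring.
  by rewrite (pb_mean_poly3 ps (fun k => k%:R - mu)) c1 c2 c3; ring.
have r0 : r != 0.
  by apply: contraTneq pn1 => e; rewrite P1 e mulr0 ltxx.
have q0 : s + r ^+ 2 + x != 0.
  by apply: contraTneq pn2 => e; rewrite P2 e mulr0 ltxx.
have n0 : phi n != 0 by rewrite gt_eqF.
have R1 : ratio n = r by rewrite /touchard_ratio P1; field.
have R2 : ratio n.+1 = (s + r ^+ 2 + x) / r by rewrite /touchard_ratio P1 P2; field; rewrite n0 r0.
have R3 : ratio n.+2 = (ka + 3 * r * s + r ^+ 3 + 3 * x * r + x) / (s + r ^+ 2 + x).
  by rewrite /touchard_ratio P2 P3; field; rewrite n0 q0.
split=> //.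
- by rewrite /touchard_spread R1 R2; field.
- by rewrite /touchard_spread R1 R2 R3; field; rewrite r0 q0.
Qed.

(** The variance of a Bernoulli sum is at most its mean. *)
Lemma spread_le_ratio n : spread n <= ratio n.
Proof.
by have [ps [hps _ -> -> _]] := ratio_pb n; rewrite lerD2r pb_var_le_mu.
Qed.

Lemma spread_ge n : x <= spread n.
Proof. by have [ps [hps _ _ -> _]] := ratio_pb n; rewrite lerDr pb_var_ge0. Qed.

(** In the recursion of [ratio_pb], the third cumulant is at least minus the
    variance, and spread / ratio is at most 1. *)
Lemma spread_succ_ge n : spread n - 2 <= spread n.+1.
Proof.
have [ps [hps _ _ sE ->]] := ratio_pb n.
have r0 := ratio_gt0 n; have vr := spread_le_ratio n; have vx := spread_ge n.
have k := pb_kappa3_ge hps.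
set r := ratio n in r0 vr *; set v := spread n in vr vx sE *.
have h1 : v / r <= 1 by rewrite ler_pdivrMr// mul1r.
have h0 : 0 <= v / r by rewrite divr_ge0// ltW// (lt_le_trans x0).
have h2 : - 1 <= (pb_kappa3 ps + x) / r.
  rewrite ler_pdivlMr// mulN1r; move: x0 => x0'; lra.
nra.
Qed.

End Touchard.

(** * Divergence of the variance *)

Section Growth.
Variables (R : rcfType) (x : R).
Hypothesis x0 : 0 < x.
Local Notation M := (stirling_sum x).
Local Notation phi := (touchard_value x).
Local Notation ratio := (touchard_ratio x).
Local Notation spread := (touchard_spread x).

(** In a partition of n + 1 points, remove the block of one given point: if j of the
    other points lie outside of it, they form an arbitrary partition of j points. *)
Lemma stirling_sum_binomial n f :
  M n.+1 f = x * \sum_(j < n.+1) 'C(n, j)%:R * M j (fun k => f k.+1).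
Proof.
elim: n f => [|n IHn] f.
  by rewrite big_ord1 bin0 /= mul0r add0r mul1r.
rewrite -[LHS]/(M n.+1 (fun k => k%:R * f k + x * f k.+1)) IHn; congr (_ * _).
set g := fun k => f k.+1.
have E j : M j (fun k => k.+1%:R * f k.+1 + x * f k.+2) = M j.+1 g + M j g.
  by rewrite /= -stirling_sumD; apply: eq_stirling_sum => k; rewrite -natr1 /g; ring.
under eq_bigr do rewrite E mulrDr; rewrite big_split /=.
rewrite [RHS]big_ord_recl /= bin0 mul1r.
under [in RHS]eq_bigr do rewrite /bump /= add1n binS natrD mulrDl.
rewrite big_split /= addrA [RHS]addrC; congr (_ + _).
have := @big_ord_recl R 0 +%R n.+1 (fun j : 'I_n.+2 => 'C(n, j)%:R * M j g).
by rewrite big_ord_recr /= bin_small// mul0r addr0 bin0 mul1r.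
Qed.

(** The total weight of the partitions of n + 1 points in which the block of a given
    point contains j other points. *)
Definition block_weight n j := x * 'C(n, j)%:R * phi (n - j).

Lemma sum_block_weight n : \sum_(j < n.+1) block_weight n j = phi n.+1.
Proof.
rewrite {1}/touchard_value stirling_sum_binomial mulr_sumr (reindex_inj rev_ord_inj) /=.
apply: eq_bigr => j _; rewrite /block_weight subSS.
have jn : (j <= n)%N by rewrite -ltnS.
by rewrite subKn// bin_sub// mulrA.
Qed.

Lemma sum_block_weight_id n :
  \sum_(j < n.+2) j%:R * block_weight n.+1 j = n.+1%:R * phi n.+1.
Proof.
rewrite big_ord_recl mul0r add0r -sum_block_weight mulr_sumr.
apply: eq_bigr => j _; rewrite /block_weight lift0 subSS.
rewrite mulrA mulrCA -natrM -mul_bin_diag natrM; ring.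
Qed.

Lemma sum_block_weight_ffact n :
  \sum_(j < n.+3) (j%:R * (j%:R - 1)) * block_weight n.+2 j =
  n.+2%:R * n.+1%:R * phi n.+1.
Proof.
rewrite 2!big_ord_recl mul0r mul0r add0r lift0 subrr mulr0 mul0r add0r.
rewrite -sum_block_weight mulr_sumr.
apply: eq_bigr => j _; rewrite /block_weight !lift0 !subSS.
have E : j.+2%:R * (j.+2%:R - 1) * 'C(n.+2, j.+2)%:R = n.+2%:R * n.+1%:R * 'C(n, j)%:R :> R.
  have -> : j.+2%:R - 1 = j.+1%:R :> R by rewrite -natr1 addrK.
  rewrite -!natrM; congr (_%:R).
  by rewrite mulnAC -mul_bin_diag -mulnA [('C(_, _) * _)%N]mulnC -mul_bin_diag mulnA.
transitivity (x * phi (n - j) * (j.+2%:R * (j.+2%:R - 1) * 'C(n.+2, j.+2)%:R)); first ring.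
by rewrite E; ring.
Qed.

(** Pascal's rule, applied to the decomposition [sum_block_weight] of phi_(n+2). *)
Lemma sum_block_weight_shift n :
  \sum_(j < n.+1) x * 'C(n, j)%:R * phi (n.+1 - j) = phi n.+2 - phi n.+1.
Proof.
have := @big_ord_recl R 0 +%R n.+1 (fun j : 'I_n.+2 => x * 'C(n, j)%:R * phi (n.+1 - j)).
rewrite big_ord_recr /= bin_small// mulr0 mul0r addr0 bin0 => ->.
rewrite -(sum_block_weight n.+1) -[X in _ - X](sum_block_weight n) subn0.
rewrite [in RHS]big_ord_recl /block_weight bin0 subn0 -addrA; congr (_ + _).
rewrite -sumrB; apply: eq_bigr => j _.
by rewrite lift0 binS natrD subSS; ring.
Qed.

Lemma block_weight_ge0 n j : 0 <= block_weight n j.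
Proof. by rewrite !mulr_ge0 ?ler0n ?ltW ?phi_gt0. Qed.

Lemma ratio_le_succ n : ratio n <= ratio n.+1.
Proof.
have r0 := ratio_gt0 x0 n; have := spread_ge x0 n; rewrite /touchard_spread => h.
by rewrite -subr_ge0 -(pmulr_rge0 _ r0) (le_trans _ h)// ltW.
Qed.

Lemma ratio_succ_le n : ratio n.+1 <= ratio n + 1.
Proof.
have r0 := ratio_gt0 x0 n; have := spread_le_ratio x0 n; rewrite /touchard_spread => h.
by rewrite -lerBlDl -(ler_pM2l r0) mulr1.
Qed.

Lemma ratio_homo m n : (m <= n)%N -> ratio m <= ratio n.
Proof. by move/(homo_leq (@lexx _ R) (@le_trans _ R) ratio_le_succ). Qed.

Lemma ratio_drop n j : ratio (n + j) - ratio n <= j%:R.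
Proof.
elim: j => [|j IHj]; first by rewrite addn0 subrr.
have := ratio_succ_le (n + j); rewrite addnS -natr1; lra.
Qed.

Lemma ratio_upper n : ratio n <= n%:R + x.
Proof.
have := ratio_drop 0 n; rewrite add0n -[ratio 0](_ : x = _) ?lerBlDr//.
by rewrite /touchard_ratio /touchard_value /= mul0r add0r divr1 mulr1.
Qed.

(** Read backwards, [spread_succ_ge] says that spreads at earlier indices are
    controlled by the present one. *)
Lemma spread_back n j : spread n <= spread (n + j) + 2 * j%:R.
Proof.
elim: j => [|j IHj]; first by rewrite addn0 mulr0 addr0.
have := spread_succ_ge x0 (n + j); rewrite addnS -natr1; lra.
Qed.

(** Each increment of the ratio is spread / ratio.  If j is less than half of the final
    ratio, all these quotients are bounded through [spread_back]; otherwise the trivial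
    bound j on the drop suffices. *)
Lemma ratio_drop_spread n j :
  (ratio (n + j) - ratio n) * ratio (n + j) <=
  2 * spread (n + j) * j%:R + 4 * j%:R ^+ 2.
Proof.
set r := ratio (n + j); set v := spread (n + j).
have v0 : 0 <= v by apply: le_trans (spread_ge x0 _); exact: ltW.
have r0 : 0 < r := ratio_gt0 x0 _.
have j0 : 0 <= j%:R :> R := ler0n _ _.
have dj := ratio_drop n j; rewrite -/r in dj.
have d0 : ratio n <= r by apply: ratio_homo; rewrite leq_addr.
have [h|h] := leP (r / 2) j%:R; first by nra.
have q0 : 0 < ratio n := ratio_gt0 x0 n.
have loc i : (i <= j)%N -> (ratio (n + i) - ratio n) * ratio n <= i%:R * (v + 2 * j%:R).
  elim: i => [|i IHi] ij; first by rewrite addn0 subrr !mul0r.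
  have := IHi (ltnW ij); rewrite addnS -natr1.
  have vi : spread (n + i) <= v + 2 * j%:R.
    have := spread_back (n + i) (j - i); rewrite -addnA subnKC ?(ltnW ij)// -/v.
    have : ((j - i)%:R : R) <= j%:R by rewrite ler_nat leq_subr.
    lra.
  have ri : ratio n <= ratio (n + i) by apply: ratio_homo; rewrite leq_addr.
  have := ratio_le_succ (n + i); rewrite {1}/touchard_spread in vi.
  by move: (ratio (n + i)) (ratio (n + i).+1) ri vi => a b; nra.
have := loc j (leqnn j); rewrite -/r => E.
have q2 : r / 2 <= ratio n by lra.
nra.
Qed.

(** The drops in the identity phi_N (r - v) = sum_j w_j (r - r_(N-j)) are bounded by
    [ratio_drop_spread], and the resulting first and second moments of j under the weights
    w_j are known exactly. *)
Lemma spread_lower n :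
  (ratio n.+2 - spread n.+2) * ratio n.+2 <=
  2 * spread n.+2 * n.+2%:R + 4 * n.+2%:R + 4 * n.+2%:R ^+ 2 / ratio n.+1.
Proof.
set N := n.+2; set r := ratio N; set v := spread N.
have pN : 0 < phi N by exact: phi_gt0.
have pN1 : 0 < phi n.+1 by exact: phi_gt0.
have r0 : 0 < r := ratio_gt0 x0 _.
(* The average drop of the ratio is r - v, by the two decompositions of phi. *)
have E : phi N * (r - v) = \sum_(j < N.+1) block_weight N j * (r - ratio (N - j)).
  under eq_bigr do rewrite mulrBr.
  rewrite sumrB -mulr_suml sum_block_weight.
  rewrite [X in _ = _ - X](_ : _ = \sum_(j < N.+1) x * 'C(N, j)%:R * phi (N.+1 - j)).
    rewrite sum_block_weight_shift /r /v /touchard_spread /touchard_ratio.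
    by field; rewrite !gt_eqF ?phi_gt0.
  apply: eq_bigr => j _; rewrite /block_weight /touchard_ratio subSn; last by rewrite -ltnS.
  by rewrite -!mulrA; congr (_ * (_ * _)); field; rewrite gt_eqF ?phi_gt0.
rewrite -(ler_pM2l pN) mulrA E mulr_suml.
apply: (@le_trans _ _ (\sum_(j < N.+1) ((2 * v + 4) * (j%:R * block_weight N j)
     + 4 * (j%:R * (j%:R - 1) * block_weight N j)))).
  apply: ler_sum => j _; have jN : (j <= N)%N by rewrite -ltnS.
  have := ratio_drop_spread (N - j) j; rewrite subnK// -/r -/v => h.
  rewrite -[leLHS]mulrA; apply: (le_trans (ler_wpM2l (block_weight_ge0 N j) h)).
  by rewrite le_eqVlt; apply/orP; left; apply/eqP; ring.
rewrite big_split /= -!mulr_sumr sum_block_weight_id sum_block_weight_ffact.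
have -> : ratio n.+1 = phi N / phi n.+1 by [].
rewrite -[leRHS](_ : (2 * v + 4) * (N%:R * phi N) + 4 * (N%:R ^+ 2 * phi n.+1) = _); last first.
  by field; rewrite !gt_eqF.
rewrite lerD2l ler_pM2l// (ler_wpM2r (ltW pN1))// expr2 ler_wpM2l//.
by rewrite ler_nat.
Qed.

Lemma stirling_sum_le n f g : (forall k, f k <= g k) -> M n f <= M n g.
Proof.
move=> fg; rewrite -subr_ge0 -[X in _ - X]mul1r -mulNr -stirling_sumZ -stirling_sumD.
by apply: stirling_sum_ge0 => // k; rewrite mulN1r subr_ge0.
Qed.

(** There are at least m ^ i partitions of m + i points into m blocks: put the first m
    points in distinct blocks. *)
Lemma phi_lower m i : m%:R ^+ i * x ^+ m <= phi (m + i).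
Proof.
pose e (m k : nat) : R := (k == m)%:R.
have e0 p k : 0 <= e p k by rewrite ler0n.
suff H : m%:R ^+ i * x ^+ m <= M (m + i) (e m).
  by apply: (le_trans H); apply: stirling_sum_le => k; rewrite lern1 leq_b1.
elim: i => [|i IHi].
  rewrite addn0 expr0 mul1r; elim: m => [|m IHm]; first by rewrite expr0.
  rewrite exprS; apply: (le_trans (ler_wpM2l (ltW x0) IHm)).
  rewrite -stirling_sumZ /=; apply: stirling_sum_le => k.
  by rewrite /e eqSS lerDr mulr_ge0.
rewrite exprS -mulrA; apply: (le_trans (ler_wpM2l (ler0n _ m) IHi)).
rewrite addnS -stirling_sumZ /=; apply: stirling_sum_le => k.
rewrite {1 2}/e; case: eqP => [->|_]; last by rewrite !mulr0 add0r mulr_ge0// ltW.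
by rewrite lerDl mulr_ge0// ltW.
Qed.

Lemma phi_le_ratio n : phi n <= ratio n ^+ n.
Proof.
elim: n => [|n IHn]; first by rewrite expr0.
have r0 := ratio_gt0 x0 n; have rr := ratio_le_succ n.
have -> : phi n.+1 = ratio n * phi n by rewrite /touchard_ratio divfK// gt_eqF ?phi_gt0.
rewrite exprS; apply: ler_pM => //; [exact: ltW|exact/ltW/phi_gt0|].
by apply: (le_trans IHn); apply: lerXn2r; rewrite // nnegrE ltW// (lt_le_trans r0).
Qed.

(** Since phi_n is the product of the first n ratios, which increase, r_n ^ n is at least
    phi_n; for n = 4 m, m blocks, compare m-th powers. *)
Lemma ratio_growth m : x * m%:R ^+ 3 <= ratio (4 * m) ^+ 4.
Proof.
case: m => [|m]; first by rewrite expr0n mulr0 exprn_ge0// ltW ?ratio_gt0.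
have r0 := ratio_gt0 x0 (4 * m.+1).
rewrite -(@ler_pXn2r _ m.+1)// ?nnegrE; last 2 first.
- by rewrite mulr_ge0 ?exprn_ge0 ?(ltW x0).
- by rewrite exprn_ge0// ltW.
have := le_trans (phi_lower m.+1 (3 * m.+1)) (phi_le_ratio _).
by rewrite -mulSn [(x * _) ^+ _]exprMn -!exprM mulrC.
Qed.

(** Let y be the index, q the preceding ratio and a = y / q.  Then [spread_lower] yields
    y <= 4 a^2 (v + 1 + a), while [ratio_growth] gives c a^4 <= y; for large y these are
    incompatible with a bounded v. *)
Lemma spread_unbounded (B : R) :
  exists N : R, forall n, N <= n%:R -> B <= spread n.
Proof.
wlog B0 : B / 0 <= B.
  move=> H; have [/H//|B0] := leP 0 B; have [N HN] := H 0 (lexx _).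
  by exists N => n /HN; apply: le_trans; exact: ltW.
pose c := x / 512; have c0 : 0 < c by rewrite divr_gt0.
(* Beyond A the quartic c a^4 dominates 4 a^2 (B + 1 + a). *)
pose A := 4 * (B + 2) / c + 1.
have A1 : 1 <= A by rewrite lerDr divr_ge0 ?(ltW c0)//; lra.
(* 8 makes (n - 1) / 4 rounded down at least n / 8, and x makes r at most 2 n. *)
exists (8 + x + 4 * A ^+ 2 * (B + 1 + A)) => n nN.
have P0 : 0 <= 4 * A ^+ 2 * (B + 1 + A) by rewrite !mulr_ge0 ?sqr_ge0//; lra.
have n8R : 8%:R <= n%:R :> R by move: x0; lra.
have n8 : (8 <= n)%N by rewrite -(ler_nat R).
case: n n8 nN n8R => [//|[//|n]] n8 nN n8R.
have := spread_lower n; set r := ratio n.+2; set q := ratio n.+1; set v := spread n.+2.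
set y : R := n.+2%:R in nN n8R *.
have rq : q <= r := ratio_le_succ _.
have q0 : 0 < q := ratio_gt0 x0 _.
have ry : r <= 2 * y by have := ratio_upper n.+2; rewrite -/r -/y; lra.
have qy : c * y ^+ 3 <= q ^+ 4.
  have : x * (n.+1 %/ 4)%:R ^+ 3 <= q ^+ 4.
    apply: (le_trans (ratio_growth _)).
    apply: lerXn2r; rewrite ?nnegrE ?(ltW q0) ?(ltW (ratio_gt0 x0 _))//.
    by apply: ratio_homo; rewrite mulnC leq_divM.
  apply: le_trans; rewrite /c -mulrA ler_wpM2l ?(ltW x0)//.
  rewrite -[leLHS](_ : (y / 8) ^+ 3 = _); last by field.
  apply: lerXn2r; rewrite ?nnegrE ?divr_ge0 ?ler0n//.
  rewrite ler_pdivrMr// /y -natrM ler_nat.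
  by clear -n8; lia.
have y0 : 0 < y by lra.
have v0 : 0 <= v by apply: le_trans (spread_ge x0 _); exact: ltW.
pose a := y / q; have a0 : 0 < a by rewrite divr_gt0.
have aq : y = a * q by rewrite /a divfK// gt_eqF.
have ay : c * a ^+ 4 <= y.
  rewrite -(@ler_pM2r _ (q ^+ 4)) ?exprn_gt0// -mulrA -exprMn -aq.
  by have := ler_wpM2l (ltW y0) qy; rewrite exprS; congr (_ <= _); ring.
rewrite -[4 * y ^+ 2 / q](_ : 4 * y * a = _); last by rewrite /a; field; rewrite gt_eqF.
move=> H.
have H1 : r ^+ 2 <= 4 * y * (v + 1 + a) by nra.
have H2 : q ^+ 2 <= 4 * y * (v + 1 + a).
  by apply: le_trans H1; apply: lerXn2r; rewrite ?nnegrE ?(ltW q0) ?(ltW (lt_le_trans q0 rq)).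
have H3 : y <= 4 * a ^+ 2 * (v + 1 + a).
  rewrite -(ler_pM2l y0) -[X in X <= _]expr2 {1}aq exprMn.
  have := ler_wpM2l (sqr_ge0 a) H2; congr (_ <= _); ring.
have H4 : 4 * a ^+ 2 * (B + 1 + a) <= y.
  have [aA|Aa] := leP a A.
    apply: (@le_trans _ _ (4 * A ^+ 2 * (B + 1 + A))); last by move: x0; lra.
    have a2 : a ^+ 2 <= A ^+ 2 by apply: lerXn2r; rewrite ?nnegrE; lra.
    apply: ler_pM; [|lra|lra|lra].
    by rewrite mulr_ge0 ?sqr_ge0.
  apply: le_trans ay; have -> : c * a ^+ 4 = a ^+ 3 * (c * a) by ring.
  have cA : 4 * (B + 2) <= c * a.
    have : c * A <= c * a by rewrite ler_pM2l// ltW.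
    rewrite {1}/A mulrDr mulr1 mulrC divfK ?gt_eqF//; lra.
  apply: (@le_trans _ _ (a ^+ 3 * (4 * (B + 2)))); last first.
    by rewrite ler_wpM2l// exprn_ge0// ltW.
  have -> : 4 * a ^+ 2 * (B + 1 + a) = a ^+ 2 * (4 * (B + 1 + a)) by ring.
  have -> : a ^+ 3 * (4 * (B + 2)) = a ^+ 2 * (4 * (a * (B + 2))) by ring.
  rewrite ler_wpM2l ?sqr_ge0// ler_wpM2l//.
  nra.
have : 4 * a ^+ 2 * (B + 1 + a) <= 4 * a ^+ 2 * (v + 1 + a) by apply: le_trans H3.
have a20 : 0 < 4 * a ^+ 2 by rewrite mulr_gt0 ?exprn_gt0.
by rewrite (ler_pM2l a20); lra.
Qed.

End Growth.

(** * Counting partitions by block pairs *)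

Lemma soppK n : involutive (@sopp n).
Proof. by case=> i b; rewrite /sopp /= negbK. Qed.

Lemma B0_signed_partition n P :
  is_B_partition P && without_zero_block P = signed_partition (@sopp n) [set: signed n] P.
Proof.
rewrite /is_B_partition /without_zero_block /signed_partition -andbA; congr (_ && _); rewrite -andbA.
apply/and3P/forall_inP => [[/forall_inP oP _ /forall_inP nz] B BP|h].
  by rewrite oP //= (nz _ BP).
split.
- by apply/forall_inP => B /h/andP[].
- rewrite (_ : [set B in P | self_opp B] = set0) ?cards0//.
  apply/setP => B; rewrite !inE; apply/negP => /andP[/h/andP[_ /negP nB]].
  exact: nB.
- by apply/forall_inP => B /h/andP[].
Qed.

Lemma sum_signed_partition0 (T : finType) (opp : T -> T) (V : nmodType) (f : nat -> V) :
  \sum_(P | signed_partition opp set0 P) f #|P| = f 0%N.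
Proof.
rewrite (big_pred1 set0) ?cards0// => P; apply/idP/eqP => [/andP[/and3P[/eqP cP _ P0] _]|->].
  apply/setP => B; rewrite inE; apply/negP => BP.
  have : B \subset set0 by rewrite -cP; apply: bigcup_sup.
  by rewrite subset0 => /eqP B0; rewrite B0 in BP; rewrite BP in P0.
apply/andP; split; last by apply/forall_inP => B; rewrite inE.
rewrite /partition /cover big_set0 eqxx inE /= andbT.
by apply/trivIsetP => B C; rewrite inE.
Qed.

(** The block pairs partition the set of blocks into two-element classes. *)
Lemma card_block_pairs n P : signed_partition (@sopp n) setT P ->
  #|P| = (#|block_pairs P| * 2)%N.
Proof.
move=> /andP[_ /forall_inP symP]; apply: card_uniform_partition.
  move=> X /imsetP[B]; rewrite inE => /andP[BP nB] ->.
  by rewrite cards2 eq_sym nB.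
have oK : involutive (@opp_block n) := opp_setK (@soppK n).
have bp X : X \in block_pairs P -> exists2 B, B \in P & X = [set B; opp_block B].
  by move=> /imsetP[B]; rewrite inE => /andP[BP _] ->; exists B.
apply/and3P; split.
- rewrite eqEsubset; apply/andP; split.
    apply/bigcupsP => X /bp[B BP ->]; apply/subsetP => C; rewrite !inE => /orP[] /eqP ->//.
    by case/andP: (symP _ BP).
  apply/subsetP => B BP; apply/bigcupP; exists [set B; opp_block B]; last by rewrite !inE eqxx.
  by apply/imsetP; exists B => //; rewrite inE BP; case/andP: (symP _ BP).
- apply/trivIsetP => X Y /bp[B BP ->] /bp[C CP ->]; apply: contraR => /pred0Pn[D /=].
  rewrite !inE => /andP[/orP[] /eqP -> /orP[] /eqP e].
  + by rewrite e.
  + by rewrite e oK setUC.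
  + by rewrite -e oK setUC.
  + by rewrite (can_inj oK e).
- apply/negP => /bp[B _ /setP/(_ B)]; by rewrite !inE eqxx.
Qed.

Section Count.
Variables (R : rcfType) (n : nat).

Let D j : {set signed n} := [set x : signed n | (x.1 < j)%N].

(** The ground set grows by one pair {j, -j} at a time.  A signed partition with k pairs has
    2 k blocks, and 2 k f + f' = 2 (k f + f' / 2) turns the recursion into that of
    [stirling_sum] at 1/2. *)
Lemma sum_signed_partition_initial j (f : nat -> R) : (j <= n)%N ->
  \sum_(P | signed_partition (@sopp n) (D j) P) f #|P| =
  2 ^+ j * stirling_sum 2^-1 j (fun k => f k.*2).
Proof.
elim: j f => [|j IHj] f jn.
  have -> : D 0 = set0 by apply/setP => x; rewrite !inE ltn0.
  by rewrite sum_signed_partition0 expr0 mul1r.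
pose t : signed n := (Ordinal jn, false).
have -> : D j.+1 = t |: (sopp t |: D j).
  apply/setP => -[i b]; rewrite !inE /t /sopp /= -!pair_eqE /= -!val_eqE /= ltnS leq_eqVlt.
  by case: b; rewrite ?andbT ?andbF ?orbF //= ?orbF //.
rewrite sum_signed_partition_insert.
- rewrite (IHj (fun m => f m *+ m + f m.+2)) ?(ltnW jn)// exprSr -mulrA; congr (_ * _).
  rewrite /= -stirling_sumZ; apply: eq_stirling_sum => k.
  by rewrite -doubleS -[f _ *+ _]mulr_natl -mul2n natrM; field.
- exact: soppK.
- by apply/setP => x; rewrite (mem_opp (@soppK n)) !inE.
- by rewrite inE ltnn.
- by rewrite /sopp -pair_eqE /= andbF.
Qed.

Lemma sum_B0_partition (f : nat -> R) :
  \sum_(p : B0_partition n) f #|block_pairs (val p)| = 2 ^+ n * stirling_sum 2^-1 n f.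
Proof.
have <- := eq_stirling_sum (2^-1 : R) n (fun k => congr1 f (doubleK k)).
rewrite -(sum_signed_partition_initial (fun m => f m./2)) ?leqnn//.
have -> : D n = setT by apply/setP => x; rewrite !inE ltn_ord.
rewrite (eq_bigl (fun P => P \in [pred P | is_B_partition P && without_zero_block P])); last first.
  by move=> P; rewrite inE B0_signed_partition.
rewrite [RHS](eq_bigr (fun P => f #|block_pairs P|)); last first.
  move=> P; rewrite inE B0_signed_partition => /card_block_pairs ->.
  by rewrite muln2 doubleK.
by rewrite [RHS]big_sub.
Qed.

End Count.

From mathcomp Require Import all_classical all_reals all_analysis measurable_realfun.
Import numFieldNormedType.Exports.
Local Open Scope classical_set_scope.

(** * Stein's identity for sums of independent Bernoulli variables *)

Section MeanValue.
Variable R : realType.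
Implicit Types (f df : R -> R).

Lemma mean_value f df (s t : R) : s <= t ->
  (forall x, s <= x <= t -> is_derive x 1 f (df x)) ->
  exists2 c, s <= c <= t & f t - f s = df c * (t - s).
Proof.
move=> st h; have [||c cst E] := @MVT_segment R f df s t st.
- by move=> x; rewrite in_itv /= => /andP[/ltW sx /ltW xt]; apply: h; rewrite sx.
- apply: derivable_within_continuous => x; rewrite in_itv /= => xst.
  by have [] := h x xst.
- by exists c => //; move: cst; rewrite in_itv.
Qed.

Lemma lipschitz_bounded_derive f df (L : R) :
  (forall x : R, is_derive x 1 f (df x)) -> (forall x, `|df x| <= L) ->
  forall s t, `|f s - f t| <= L * `|s - t|.
Proof.
move=> h hL s t; wlog st : s t / s <= t.
  by move=> H; have [/H//|/ltW/H] := leP s t; rewrite distrC (distrC t).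
have [c _ E] := mean_value st (fun x (_ : s <= x <= t) => h x).
by rewrite distrC E normrM (distrC t) ler_wpM2r.
Qed.

End MeanValue.

Section SteinPoissonBinomial.
Variable R : realType.

(** Conditioning on one Bernoulli variable X of parameter p leaves the term
    p (1 - p) E[g(K' + 1) - g(K')], to be compared with p (1 - p) E[g'(K' + X)]; the mean value
    theorem makes the difference at most L.  The free shift a makes the induction work. *)
Lemma pb_stein (ps : seq R) (g dg : R -> R) (L : R) : all (@is_proba R) ps ->
  (forall t : R, is_derive t 1 g (dg t)) ->
  (forall s t, `|s - t| <= 1 -> `|dg s - dg t| <= L) ->
  forall a, `|pb_mean ps (fun k => (k%:R - pb_mu ps) * g (k%:R + a))
      - pb_var ps * pb_mean ps (fun k => dg (k%:R + a))| <= pb_var ps * L.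
Proof.
move=> + gd gL; elim: ps => [|p ps IHs] /=.
  by move=> _ a; rewrite /pb_mu /pb_var !big_nil subr0 !mul0r subrr normr0.
move=> /andP[/andP[p0 p1] hps] a.
have {}IHs b := IHs hps b.
set mu := pb_mu ps in IHs *; set v := pb_var ps in IHs *.
have -> : pb_mu (p :: ps) = p + mu by rewrite /pb_mu big_cons.
have -> : pb_var (p :: ps) = p * (1 - p) + v by rewrite /pb_var big_cons.
pose X b := pb_mean ps (fun k => (k%:R - mu) * g (k%:R + b)).
pose Y b := pb_mean ps (fun k => dg (k%:R + b)).
pose Z := pb_mean ps (fun k => g (k%:R + (a + 1)) - g (k%:R + a)
   - p * dg (k%:R + (a + 1)) - (1 - p) * dg (k%:R + a)).
have q0 : 0 <= 1 - p by rewrite subr_ge0.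
have E1 : pb_mean ps (fun k => (k.+1%:R - (p + mu)) * g (k.+1%:R + a)) =
   X (a + 1) + (1 - p) * pb_mean ps (fun k => g (k%:R + (a + 1))).
  rewrite /X -pb_meanZ -pb_meanD; apply: eq_pb_mean => k.
  rewrite -natr1 (_ : k%:R + 1 + a = k%:R + (a + 1)); last ring.
  by ring.
have E2 : pb_mean ps (fun k => (k%:R - (p + mu)) * g (k%:R + a)) =
   X a + (- p) * pb_mean ps (fun k => g (k%:R + a)).
  by rewrite /X -pb_meanZ -pb_meanD; apply: eq_pb_mean => k; ring.
have E3 : pb_mean ps (fun k => dg (k.+1%:R + a)) = Y (a + 1).
  apply: eq_pb_mean => k; rewrite -natr1; congr dg; ring.
have EZ : Z = pb_mean ps (fun k => g (k%:R + (a + 1))) - pb_mean ps (fun k => g (k%:R + a))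
    - p * Y (a + 1) - (1 - p) * Y a.
  set A := pb_mean ps (fun k => g (k%:R + (a + 1))); set B := pb_mean ps (fun k => g (k%:R + a)).
  transitivity (A + (- 1) * B + (- p) * Y (a + 1) + (- (1 - p)) * Y a); last ring.
  rewrite /Z /Y /A /B -!pb_meanZ -!pb_meanD.
  by apply: eq_pb_mean => k; ring.
have Zle : `|Z| <= L.
  apply: (le_trans (pb_mean_norm _ hps)); rewrite -[leRHS](pb_mean_cst ps L).
  apply: pb_mean_le => // k; set y := k%:R + a.
  rewrite (_ : k%:R + (a + 1) = y + 1); last by rewrite /y; ring.
  have yy : y <= y + 1 by rewrite lerDl.
  have [c /andP[yc cy] ->] := mean_value yy (fun x (_ : y <= x <= y + 1) => gd x).
  rewrite (_ : _ - _ = p * (dg c - dg (y + 1)) + (1 - p) * (dg c - dg y)); last first.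
    by ring.
  have h1 : `|dg c - dg (y + 1)| <= L by apply: gL; rewrite ler_norml; apply/andP; split; lra.
  have h2 : `|dg c - dg y| <= L by apply: gL; rewrite ler_norml; apply/andP; split; lra.
  apply: (le_trans (ler_normD _ _)); rewrite !normrM (ger0_norm p0) (ger0_norm q0).
  have := ler_wpM2l p0 h1; have := ler_wpM2l q0 h2; lra.
rewrite E1 E2 E3 -/(Y a).
set W := _ - _.
have -> : W = p * (X (a + 1) - v * Y (a + 1)) + (1 - p) * (X a - v * Y a)
   + p * (1 - p) * Z by rewrite /W EZ; ring.
have pq0 : 0 <= p * (1 - p) by rewrite mulr_ge0.
apply: (le_trans (ler_normD _ _)); rewrite normrM (ger0_norm pq0).
apply: (@le_trans _ _ (v * L + p * (1 - p) * L)); last by rewrite -mulrDl addrC.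
apply: lerD; last by rewrite ler_wpM2l.
apply: (le_trans (ler_normD _ _)); rewrite !normrM (ger0_norm p0) (ger0_norm q0).
have := ler_wpM2l p0 (IHs (a + 1)); have := ler_wpM2l q0 (IHs a).
rewrite -/(X a) -/(X (a + 1)) -/(Y a) -/(Y (a + 1)); lra.
Qed.

End SteinPoissonBinomial.

(** * The standard Gaussian density and its tails *)

Section Gaussian.
Variable R : realType.
Implicit Types (t c : R).

Definition gauss : R -> R := normal_pdf 0 1.

Lemma gaussE t : gauss t = normal_peak 1 * expR (- t ^+ 2 / 2).
Proof. by rewrite /gauss normal_pdfE ?oner_eq0// /normal_fun subr0 expr1n. Qed.

Lemma gauss_gt0 t : 0 < gauss t.
Proof. by rewrite gaussE mulr_gt0 ?expR_gt0 ?normal_peak_gt0 ?oner_eq0. Qed.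

Lemma gaussN t : gauss (- t) = gauss t.
Proof. by rewrite !gaussE sqrrN. Qed.

Lemma is_derive_gauss t : is_derive t 1 gauss (- t * gauss t).
Proof.
have -> : gauss = fun t => normal_peak 1 * expR (- t ^+ 2 / 2).
  by apply/funext => s; rewrite gaussE.
have dq : is_derive t 1 (fun t : R => - t ^+ 2 / 2) (- t).
  by apply: is_derive_eq; rewrite /GRing.scale /=; field.
have de := @is_derive1_comp _ expR _ t _ _ (is_derive_expR _) dq.
have := is_deriveZ (normal_peak 1) de; rewrite /GRing.scale /= => dg.
by apply: (is_derive_eq dg) => /=; ring.
Qed.

Lemma continuous_gauss : continuous gauss.
Proof. exact/continuous_normal_pdf/oner_neq0. Qed.

Lemma cvg_gauss_pinfty : gauss t @[t --> +oo] --> 0.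
Proof.
apply: (@squeeze_cvgr _ _ _ _ (fun=> 0) (fun t => normal_peak 1 * expR (- t))).
- near=> t; rewrite (ltW (gauss_gt0 _)) /= gaussE.
  rewrite ler_wpM2l ?normal_peak_ge0// ler_expR mulNr lerN2.
  have t2 : 2 <= t by near: t; apply: nbhs_pinfty_ge; exact: num_real.
  by rewrite ler_pdivlMr// expr2 ler_wpM2l// (le_trans _ t2).
- exact: cvg_cst.
- rewrite -[X in _ --> X](mulr0 (normal_peak 1)).
  by apply: cvgM; [exact: cvg_cst|exact: cvgr_expR].
Unshelve. all: by end_near. Qed.

Lemma ge0_derive_cvg0_le0 (U dU : R -> R) (A : R) :
  (forall x : R, A <= x -> is_derive x 1 U (dU x)) ->
  (forall x : R, A <= x -> 0 <= dU x) ->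
  U t @[t --> +oo] --> 0 -> forall t : R, A <= t -> U t <= 0.
Proof.
move=> dU1 dU0 U0 t At; apply: (cvgr_to_ge U0).
near=> s; have ts : t <= s by near: s; apply: nbhs_pinfty_ge; exact: num_real.
have [|c /andP[tc _] E] := @mean_value R U dU t s ts.
  by move=> x /andP[tx _]; apply: dU1; apply: le_trans tx.
by rewrite -subr_ge0 E mulr_ge0 ?subr_ge0// dU0// (le_trans At).
Unshelve. all: by end_near. Qed.

(** Both bounds minus F are functions vanishing at infinity whose derivatives have a
    constant sign. *)
Lemma mills_ratio (F : R -> R) (A c : R) : 0 < A -> 0 <= c ->
  (forall x : R, A <= x -> is_derive x 1 F (- c * gauss x)) ->
  F t @[t --> +oo] --> 0 -> forall t : R, A <= t ->
  c * (t / (1 + t ^+ 2) * gauss t) <= F t <= c * (gauss t / t).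
Proof.
move=> A0 c0 dF F0 t At.
have den x : 1 + x ^+ 2 != 0 :> R by rewrite gt_eqF// ltr_wpDr ?sqr_ge0.
have gc (k : R -> R) : (\forall x \near +oo, 0 <= k x <= 1) -> c * (k x * gauss x) @[x --> +oo] --> 0.
  move=> hk; rewrite -[X in _ --> X](mulr0 c); apply: cvgM; first exact: cvg_cst.
  apply: (@squeeze_cvgr _ _ _ _ (fun=> 0) gauss _); last exact: cvg_gauss_pinfty; last exact: cvg_cst.
  near=> x; have /(_ _)/andP[//|k0 k1] := near hk x.
  by rewrite mulr_ge0 ?(ltW (gauss_gt0 _))//= ler_piMl// ltW// gauss_gt0.
apply/andP; split; rewrite -subr_le0.
- pose U (x : R) := c * (x / (1 + x ^+ 2) * gauss x) - F x.
  pose dU (x : R) := 2 * c * gauss x / (1 + x ^+ 2) ^+ 2.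
  apply: (@ge0_derive_cvg0_le0 U dU A); last exact: At.
  + move=> x Ax; have := is_derive_gauss x; have := dF x Ax => dFx dgx.
    have dq : is_derive x 1 (fun x : R => 1 + x ^+ 2) (2 * x).
      by apply: is_derive_eq; rewrite /GRing.scale /=; ring.
    have dV : is_derive x 1 (fun x : R => (1 + x ^+ 2)^-1) (- (1 + x ^+ 2) ^- 2 * (2 * x)).
      exact: (is_derive_eq (@is_deriveV _ (fun x : R => 1 + x ^+ 2) x _ 1 (den x) dq) erefl).
    apply: is_derive_eq; rewrite /GRing.scale /= /dU; field; exact: den.
  + by move=> x Ax; rewrite /dU !mulr_ge0 ?invr_ge0 ?sqr_ge0 ?(ltW (gauss_gt0 _)).
  + rewrite -[X in _ --> X](subr0 0); apply: cvgB => //; apply: gc.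
    near=> x; have x1 : 1 <= x by near: x; apply: nbhs_pinfty_ge; exact: num_real.
    have q0 : 0 < 1 + x ^+ 2 by rewrite ltr_wpDr ?sqr_ge0.
    have x0 : 0 <= x by apply: le_trans x1.
    rewrite divr_ge0 ?(ltW q0)//= ler_pdivrMr// mul1r; nra.
- pose U (x : R) := F x - c * (gauss x / x).
  pose dU (x : R) := c * gauss x / x ^+ 2.
  apply: (@ge0_derive_cvg0_le0 U dU A); last exact: At.
  + move=> x Ax; have := is_derive_gauss x; have := dF x Ax => dFx dgx.
    have x0 : x != 0 by rewrite gt_eqF// (lt_le_trans A0).
    have dV : is_derive x 1 (fun x : R => x^-1) (- x ^- 2 * 1).
      exact: (is_derive_eq (@is_deriveV _ (fun x : R => x) x _ 1 x0 (is_derive_id x 1)) erefl).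
    by apply: is_derive_eq; rewrite /GRing.scale /= /dU; field.
  + by move=> x Ax; rewrite /dU !mulr_ge0 ?invr_ge0 ?exprn_even_ge0 ?(ltW (gauss_gt0 _)).
  + rewrite -[X in _ --> X](subr0 0); apply: cvgB => //.
    under eq_fun do rewrite [gauss _ / _]mulrC.
    apply: gc; near=> x; have x1 : 1 <= x by near: x; apply: nbhs_pinfty_ge; exact: num_real.
    by rewrite invr_ge0 invf_le1 ?x1 ?andbT ?(le_trans _ x1) ?(lt_le_trans _ x1).
Unshelve. all: by end_near. Qed.

End Gaussian.

(** * Stein's equation *)

Section SteinEquation.
Variable R : realType.
Implicit Types (t c : R).

Lemma continuous_bounded (G : R -> R) (A : R) : continuous G ->
  exists M : R, forall t, `|t| <= A -> `|G t| <= M.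
Proof.
move=> cG; have [A0|A0] := leP 0 A; last first.
  by exists 0 => t tA; have := le_lt_trans (normr_ge0 t) (le_lt_trans tA A0); rewrite ltxx.
have AA : - A <= A by lra.
have [|c _ hc] := @EVT_max R (fun t => `|G t|) (- A) A AA.
  by apply: continuous_subspaceT => t; apply: cvg_norm; exact: cG.
by exists `|G c| => t; rewrite ler_norml => tA; apply: hc; rewrite in_itv.
Qed.

(** The solution is f = F / gauss.  Its derivative is t f(t) + h(t) - c, and t f(t) has
    derivative (1 + t^2) f(t) + t (h(t) - c).  The latter is continuous, and bounded near
    both infinities by the two-sided Mills bounds, which cancel its linear growth. *)
Lemma stein_equation (h F : R -> R) (a b c K : R) :
  0 <= c <= 1 -> continuous h ->
  (forall t, t <= a -> h t = 1) -> (forall t, b <= t -> h t = 0) ->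
  (forall s t, `|h s - h t| <= K * `|s - t|) ->
  (forall t : R, is_derive t 1 F ((h t - c) * gauss t)) ->
  F t @[t --> +oo] --> 0 -> F (- t) @[t --> +oo] --> 0 ->
  exists f df : R -> R, exists L : R,
    [/\ forall t : R, is_derive t 1 f (df t),
        forall t, df t = t * f t + (h t - c) &
        forall s t, `|df s - df t| <= L * `|s - t|].
Proof.
move=> /andP[c0 c1] ch ha hb hK dF Fy FNy.
pose f t := F t / gauss t; pose df t := t * f t + (h t - c).
have g0 t : gauss t != 0 by rewrite gt_eqF// gauss_gt0.
have dfE t : is_derive t 1 f (df t).
  have dFt := dF t.
  have dV := @is_deriveV _ (@gauss R) t _ 1 (g0 t) (is_derive_gauss t).
  have dM := is_deriveM dFt dV.
  apply: (is_derive_eq dM); rewrite /GRing.scale /= /df /f; field; exact: g0.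
pose w t := t * f t; pose dw t := (1 + t ^+ 2) * f t + t * (h t - c).
have dwE t : is_derive t 1 w (dw t).
  have dM := is_deriveM (is_derive_id t 1) (dfE t).
  by apply: (is_derive_eq dM); rewrite /GRing.scale /= /dw /df; ring.
pose A := 1 + `|a| + `|b|.
have A0 : 0 < A by rewrite /A !ltr_wpDr.
have A1 : 1 <= A by rewrite /A -addrA lerDl addr_ge0.
have Aa : - A <= a by have := ler_norm (- a); rewrite normrN /A; have := normr_ge0 b; lra.
have Ab : b <= A by have := ler_norm b; rewrite /A; have := normr_ge0 a; lra.
(* Both tails reduce to this estimate, with e = c on the right and e = 1 - c on the left. *)
have key (e t fe : R) : 0 <= e <= 1 -> A <= t ->
    e * (t / (1 + t ^+ 2) * gauss t) <= fe * gauss t <= e * (gauss t / t) ->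
    `|(1 + t ^+ 2) * fe - t * e| <= 1.
  move=> /andP[e0 e1] At /andP[h1 h2].
  have t1 : 1 <= t := le_trans A1 At.
  have t0 : 0 < t := lt_le_trans ltr01 t1.
  have q0 : 0 < 1 + t ^+ 2 by rewrite ltr_wpDr ?sqr_ge0.
  have l1 : e * t <= (1 + t ^+ 2) * fe.
    rewrite -(ler_pM2r (gauss_gt0 t)) -mulrA -[leRHS]mulrA.
    have := ler_wpM2l (ltW q0) h1; congr (_ <= _); field; exact: lt0r_neq0.
  have l2 : (1 + t ^+ 2) * fe <= (1 + t ^+ 2) * (e / t).
    rewrite ler_pM2l// -(ler_pM2r (gauss_gt0 t)); apply: le_trans h2 _.
    by rewrite le_eqVlt; apply/orP; left; apply/eqP; ring.
  have et : e / t <= 1 by rewrite ler_pdivrMr// mul1r; lra.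
  have e2 : (1 + t ^+ 2) * (e / t) = e * t + e / t by field; exact: lt0r_neq0.
  rewrite ler_norml; apply/andP; split; lra.
have [M HM] : exists M : R, forall t, `|t| <= A -> `|dw t| <= M.
  apply: continuous_bounded => t; rewrite /dw.
  have cf : {for t, continuous f}.
    by have [d _] := dfE t; apply/differentiable_continuous/derivable1_diffP.
  apply: cvgD.
    apply: cvgM => //; apply: cvgD; first exact: cvg_cst.
    exact: exprn_continuous.
  apply: cvgM; first exact: cvg_id.
  by apply: cvgB; [exact: ch|exact: cvg_cst].
have dwb t : `|dw t| <= Num.max M 1.
  rewrite le_max; have [tA|At] := leP `|t| A; first by rewrite HM.
  apply/orP; right; rewrite /dw.
  have [t0|t0] := leP 0 t.
    have {}At : A <= t by rewrite ger0_norm// in At; exact: ltW.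
    rewrite hb ?sub0r ?mulrN; last exact: le_trans At.
    apply: key => //; first by rewrite c0.
    rewrite /f divfK//; apply: (@mills_ratio _ F A) => // x Ax.
    by apply: (is_derive_eq (dF x)); rewrite hb ?sub0r// (le_trans Ab).
  have {}At : A <= - t by rewrite ltr0_norm// in At; exact: ltW.
  rewrite ha; last by lra.
  rewrite -[X in _ + X]opprK -mulNr -(sqrrN t); apply: key => //.
    by rewrite subr_ge0 c1 gerBl c0.
  rewrite -[gauss (- t)]gaussN opprK /f divfK//.
  have -> : F t = (F \o -%R) (- t) by rewrite /= opprK.
  rewrite -[gauss t]gaussN; apply: (@mills_ratio _ (F \o -%R) A) => //.
    by rewrite subr_ge0.
  move=> x Ax; have dc := is_derive1_comp (dF (- x)) (is_deriveNid x 1).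
  apply: (is_derive_eq dc); rewrite gaussN ha; first ring.
  lra.
exists f, df, (Num.max M 1 + K); split => // s t.
have -> : df s - df t = (w s - w t) + (h s - h t) by rewrite /df /w; ring.
rewrite mulrDl; apply: (le_trans (ler_normD _ _)); apply: lerD => //.
exact: lipschitz_bounded_derive dwE dwb s t.
Qed.

End SteinEquation.

Section NormalCdf.
Variable R : realType.
Local Notation mu := (@lebesgue_measure R).

Definition gauss_primitive (h : R -> R) (t : R) : R :=
  \int[mu]_(x in `]-oo, t]) (h x * gauss x).

Lemma is_derive_gauss_primitive (h : R -> R) (t : R) : continuous h ->
  (forall x, 0 <= h x <= 1) ->
  is_derive t 1 (gauss_primitive h) (h t * gauss t).
Proof.
move=> ch h01.
have cf : continuous (fun x => h x * gauss x).
  by move=> x; apply: cvgM; [exact: ch|exact: continuous_gauss].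
have [||d D] := @continuous_FTC1 R (fun x => h x * gauss x) -oo%O t (t + 1) _ _ (ltNyr _) (cf t).
- by rewrite ltrDl.
- apply: (@integrableS _ _ _ _ setT) => //.
  apply: (@le_integrable _ _ _ mu setT _ _ (fun x => (gauss x)%:E)) => //.
  + by apply/measurable_EFinP; exact: continuous_measurable_fun.
  + move=> x _ /=; have /andP[h0 h1] := h01 x.
    by rewrite lee_fin normrM ler_piMl// ger0_norm.
  + exact: integrable_normal_pdf.
- by apply: DeriveDef; [exact: d|rewrite -derive1E; exact: D].
Qed.

Definition normal_cdf (t : R) : R := fine (normal_prob 0 1 `]-oo, t]%classic).

Lemma normal_cdfE : normal_cdf = gauss_primitive (fun=> 1).
Proof.
apply/funext => t; rewrite /gauss_primitive; under eq_Rintegral do rewrite mul1r.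
by [].
Qed.

Definition idR : measurableTypeR R -> R := idfun.
HB.instance Definition _ := @isMeasurableFun.Build _ _ _ _ idR (@measurable_id _ _ setT).

Lemma normal_cdf_idR : normal_cdf = fine \o cdf (idR : {RV (normal_prob 0 1) >-> R}).
Proof. by apply/funext => t; rewrite /= preimage_id. Qed.

Lemma cvg_normal_cdf_ninfty : normal_cdf t @[t --> -oo] --> (0 : R).
Proof.
rewrite normal_cdf_idR; exact: (fine_cvg (cvg_cdfNy0 (idR : {RV (normal_prob 0 1) >-> R}))).
Qed.

Lemma cvg_normal_cdf_pinfty : normal_cdf t @[t --> +oo] --> (1 : R).
Proof.
rewrite normal_cdf_idR; exact: (fine_cvg (cvg_cdfy1 (idR : {RV (normal_prob 0 1) >-> R}))).
Qed.

(** The piecewise linear function equal to 1 before a and to 0 after b. *)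
Definition ramp (a b t : R) : R := Num.max 0 (Num.min 1 ((b - t) / (b - a))).

Lemma ramp01 a b t : 0 <= ramp a b t <= 1.
Proof.
by rewrite /ramp le_max lexx /= ge_max ler01 ge_min lexx.
Qed.

Lemma ramp_left a b t : a < b -> t <= a -> ramp a b t = 1.
Proof.
move=> ab ta; rewrite /ramp.
have -> : Num.min 1 ((b - t) / (b - a)) = 1.
  by apply/min_idPl; rewrite ler_pdivlMr ?subr_gt0// mul1r lerB.
by apply/max_idPr.
Qed.

Lemma ramp_right a b t : a < b -> b <= t -> ramp a b t = 0.
Proof.
move=> ab bt; rewrite /ramp; apply/max_idPl; rewrite ge_min.
by rewrite pmulr_lle0 ?invr_gt0 ?subr_gt0// subr_le0 bt orbT.
Qed.

Lemma ramp_lipschitz a b s t : a < b ->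
  `|ramp a b s - ramp a b t| <= (b - a)^-1 * `|s - t|.
Proof.
move=> ab; have ab0 : 0 < b - a by rewrite subr_gt0.
have clip (u v : R) : `|Num.max 0 (Num.min 1 u) - Num.max 0 (Num.min 1 v)| <= `|u - v|.
  rewrite /Num.min /Num.max.
  case: (ltP 1 u) => hu; case: (ltP 1 v) => hv;
  do ?[case: ifP => ?]; rewrite ler_norml; apply/andP;
  have := ler_norm (u - v); have := ler_norm (v - u); rewrite distrC; split; lra.
apply: (le_trans (clip _ _)); rewrite -mulrBl normrM mulrC.
rewrite (@ger0_norm _ (b - a)^-1) ?invr_ge0 ?(ltW ab0)//.
by rewrite (_ : b - s - (b - t) = t - s) 1?distrC//; ring.
Qed.

Lemma continuous_ramp a b : a < b -> continuous (ramp a b).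
Proof.
move=> ab t.
have c1 : {for t, continuous (fun u => (b - u) / (b - a))}.
  by apply: cvgM; [apply: cvgB; [exact: cvg_cst|exact: cvg_id]|exact: cvg_cst].
have k (v : R) : {for t, continuous (fun=> v : R)} by exact: cvg_cst.
have c2 := @continuous_min R R (fun=> 1) _ t (k 1) c1.
have c3 := @continuous_max R R (fun=> 0) _ t (k 0) c2.
have e : ramp a b = (fun=> 0) \max ((fun=> 1) \min (fun u => (b - u) / (b - a))).
  by apply/funext.
by rewrite e.
Qed.

(** The constant c is the Gaussian mean of the ramp.  The function F of
    [stein_equation] is the primitive of the ramp times the density minus c times the
    normal distribution function; it coincides with (1 - c) times the latter before a,
    and with c times its complement to 1 after b, so it vanishes at both infinities. *)
Lemma stein_ramp (a b : R) : a < b ->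
  exists c, exists f df : R -> R, exists L : R,
    [/\ normal_cdf a <= c <= normal_cdf b, forall t : R, is_derive t 1 f (df t),
        forall t, df t = t * f t + (ramp a b t - c) &
        forall s t, `|df s - df t| <= L * `|s - t|].
Proof.
move=> ab; pose H := gauss_primitive (ramp a b); pose c := H b.
have dH (t : R) : is_derive t 1 H (ramp a b t * gauss t).
  by apply: is_derive_gauss_primitive; [exact: continuous_ramp|exact: ramp01].
have dP (t : R) : is_derive t 1 normal_cdf (gauss t).
  rewrite normal_cdfE -[gauss t]mul1r; apply: (is_derive_gauss_primitive (h := fun=> 1)).
    by move=> ?; exact: cvg_cst.
  by move=> ?; rewrite ler01 lexx.
have HP t : t <= a -> H t = normal_cdf t.
  move=> ta; rewrite normal_cdfE; apply: eq_Rintegral => x; rewrite inE/= in_itv/= => xt.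
  by rewrite ramp_left// (le_trans xt).
have Hc t : b <= t -> H t = c.
  move=> bt; have [x /andP[bx _] E] := mean_value bt (fun x (_ : b <= x <= t) => dH x).
  by apply/eqP; rewrite -subr_eq0 E ramp_right// !mul0r.
have acb : normal_cdf a <= c <= normal_cdf b.
  rewrite -HP// /c; apply/andP; split.
    have [x _ E] := mean_value (ltW ab) (fun x (_ : a <= x <= b) => dH x).
    have /andP[r0 _] := ramp01 a b x.
    by rewrite -subr_ge0 E !mulr_ge0// ?subr_ge0 ?(ltW ab)// ltW// gauss_gt0.
  have dD (t : R) : is_derive t 1 (fun t => normal_cdf t - H t) (gauss t - ramp a b t * gauss t).
    exact: (is_deriveB (dP t) (dH t)).
  have [x _ /= E] := mean_value (ltW ab) (fun x (_ : a <= x <= b) => dD x).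
  rewrite -subr_ge0; have := HP a (lexx _) => Ha.
  move: E; rewrite Ha subrr subr0 => ->.
  have /andP[_ r1] := ramp01 a b x.
  rewrite mulr_ge0 ?subr_ge0 ?(ltW ab)// ler_piMl// ltW// gauss_gt0//.
have P01 t : 0 <= normal_cdf t <= 1.
  rewrite /normal_cdf fine_ge0//= -lee_fin fineK ?fin_num_measure//.
  exact: probability_le1.
have c01 : 0 <= c <= 1.
  have /andP[h1 h2] := acb; have /andP[h3 _] := P01 a; have /andP[_ h4] := P01 b.
  by rewrite (le_trans h3 h1) (le_trans h2 h4).
pose F t := H t - c * normal_cdf t.
have dF (t : R) : is_derive t 1 F ((ramp a b t - c) * gauss t).
  have dZ := is_deriveZ c (dP t).
  by apply: (is_derive_eq (is_deriveB (dH t) dZ)); rewrite /GRing.scale /=; ring.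
have Fy : F t @[t --> +oo] --> 0.
  have : c - c * normal_cdf t @[t --> +oo] --> 0.
    have e : c - c * 1 = 0 by rewrite mulr1 subrr.
    rewrite -[X in _ --> X]e; apply: cvgB; first exact: cvg_cst.
    by apply: cvgM; [exact: cvg_cst|exact: cvg_normal_cdf_pinfty].
  apply: cvg_trans; apply: near_eq_cvg; apply: filterS (nbhs_pinfty_ge (num_real b)) => t bt.
  by rewrite /F Hc.
have FNy : F (- t) @[t --> +oo] --> 0.
  have : (1 - c) * normal_cdf (- t) @[t --> +oo] --> 0.
    rewrite -[X in _ --> X](mulr0 (1 - c)); apply: cvgM; first exact: cvg_cst.
    by have := cvg_normal_cdf_ninfty; rewrite cvgNy_compNP.
  apply: cvg_trans; apply: near_eq_cvg; apply: filterS (nbhs_pinfty_ge (num_real (- a))) => t at_.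
  by rewrite /F HP; [ring|rewrite lerNl].
have [f [df [L [h1 h2 h3]]]] := stein_equation c01 (continuous_ramp ab)
  (fun t => @ramp_left a b t ab) (fun t => @ramp_right a b t ab)
  (fun s t => ramp_lipschitz s t ab) dF Fy FNy.
by exists c, f, df, L; split.
Qed.

End NormalCdf.

(** * Normal limit for sums of independent Bernoulli variables *)

Section PoissonBinomialCLT.
Variable R : realType.

Definition pb_cdf (ps : seq R) (x : R) : R :=
  pb_mean ps (fun k => ((k%:R - pb_mu ps) / Num.sqrt (pb_var ps) <= x)%R%:R).

(** For g(t) = f((t - mu) / sigma), the derivative g' varies by at most L / sigma^2 over unit
    steps, so [pb_stein] has error L; dividing by sigma gives the rate. *)
Lemma pb_ramp (a b : R) : a < b -> exists c L : R, normal_cdf a <= c <= normal_cdf b /\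
  forall ps : seq R, all (@is_proba R) ps -> 0 < pb_var ps ->
  `|pb_mean ps (fun k => ramp a b ((k%:R - pb_mu ps) / Num.sqrt (pb_var ps))) - c|
  <= L / Num.sqrt (pb_var ps).
Proof.
move=> ab; have [c [f [df [L [acb fd dfE fL]]]]] := stein_ramp ab.
exists c, L; split => // ps hps v0.
set m := pb_mu ps; set v := pb_var ps in v0 *; set s := Num.sqrt v.
have s0 : 0 < s by rewrite sqrtr_gt0.
have s2 : s ^+ 2 = v by rewrite sqr_sqrtr// ltW.
have sn : s != 0 by rewrite gt_eqF.
have L0 : 0 <= L by have := le_trans (normr_ge0 _) (fL 1 0); rewrite subr0 normr1 mulr1.
pose g (t : R) := f ((t - m) / s); pose dg (t : R) := df ((t - m) / s) / s.
have gd (t : R) : is_derive t 1 g (dg t).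
  have dq : is_derive t 1 (fun t : R => (t - m) / s) s^-1.
    by apply: is_derive_eq; rewrite /GRing.scale /=; ring.
  exact: (is_derive_eq (is_derive1_comp (fd _) dq)).
have gL (r t : R) : `|r - t| <= 1 -> `|dg r - dg t| <= L / v.
  move=> rt; rewrite /dg -mulrBl normrM (@ger0_norm _ s^-1) ?invr_ge0 ?(ltW s0)//.
  rewrite -s2 expr2 invfM mulrA ler_wpM2r ?invr_ge0 ?(ltW s0)//.
  apply: (le_trans (fL _ _)).
  rewrite -mulrBl normrM (@ger0_norm _ s^-1) ?invr_ge0 ?(ltW s0)//.
  rewrite (_ : r - m - (t - m) = r - t); last ring.
  by rewrite ler_wpM2l// ler_piMl// invr_ge0 ltW.
have := pb_stein hps gd gL 0; rewrite -/m -/v.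
rewrite [leRHS](_ : _ = L); last by rewrite mulrC divfK// gt_eqF.
rewrite (_ : _ - _ = s * (c - pb_mean ps (fun k => ramp a b ((k%:R - m) / s)))).
  rewrite normrM (gtr0_norm s0) distrC => h.
  by rewrite ler_pdivlMr// mulrC.
transitivity (pb_mean ps (fun k => s * c + (- s) * ramp a b ((k%:R - m) / s))).
  rewrite -mulNr -pb_meanZ -pb_meanD; apply: eq_pb_mean => k.
  by rewrite /g /dg addr0 -s2 dfE; field; exact: sn.
by rewrite pb_meanD pb_mean_cst pb_meanZ; ring.
Qed.

Lemma continuous_normal_cdf : continuous (@normal_cdf R).
Proof.
move=> t; have : is_derive t 1 (@normal_cdf R) (1 * gauss t).
  rewrite normal_cdfE; apply: (is_derive_gauss_primitive (h := fun=> 1)).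
    by move=> ?; exact: cvg_cst.
  by move=> ?; rewrite ler01 lexx.
by case=> d _; apply/differentiable_continuous/derivable1_diffP.
Qed.

(** The indicator of the half-line up to x lies between the ramps on [x - d/2, x] and on
    [x, x + d/2], whose Gaussian means are close to the distribution function at x.  The bound
    B on the variance is uniform in the Bernoulli parameters. *)
Lemma pb_clt (x e : R) : 0 < e -> exists B : R, forall ps : seq R,
  all (@is_proba R) ps -> B <= pb_var ps -> `|normal_cdf x - pb_cdf ps x| <= e.
Proof.
move=> e0; have e20 : 0 < e / 2 by rewrite divr_gt0.
have /cvgrPdist_lt /(_ _ e20) := @continuous_normal_cdf x.
move=> /nbhs_ballP[d /= d0 hd].
have d20 : 0 < d / 2 by rewrite divr_gt0.
have near_x y : `|x - y| < d -> `|normal_cdf x - normal_cdf y| < e / 2 by move=> xy; exact: hd.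
have xd : x < x + d / 2 by rewrite ltrDl.
have dx : x - d / 2 < x by rewrite gtrBl.
have [c1 [L1 [/andP[_ c1x] H1]]] := pb_ramp xd.
have [c2 [L2 [/andP[c2x _] H2]]] := pb_ramp dx.
pose M := Num.max (Num.max L1 L2) 0 + 1.
have M1 : L1 <= M by rewrite /M -[leLHS]addr0 lerD// !le_max lexx.
have M2 : L2 <= M by rewrite /M -[leLHS]addr0 lerD// !le_max lexx orbT.
have M0 : 0 < M by rewrite /M ltr_wpDl// le_max lexx orbT.
exists ((2 * M / e) ^+ 2) => ps hps hB.
have v0 : 0 < pb_var ps.
  by apply: lt_le_trans hB; rewrite exprn_gt0// divr_gt0// mulr_gt0.
have s0 : 0 < Num.sqrt (pb_var ps) by rewrite sqrtr_gt0.
have sB : 2 * M / e <= Num.sqrt (pb_var ps).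
  rewrite -(@ler_pXn2r _ 2)// ?nnegrE ?(ltW s0)//; last first.
    by rewrite divr_ge0 ?(ltW e0)// mulr_ge0 ?(ltW M0).
  by rewrite sqr_sqrtr ?(ltW v0).
have small L : L <= M -> L / Num.sqrt (pb_var ps) <= e / 2.
  move=> LM; rewrite ler_pdivrMr//.
  move: sB; rewrite ler_pdivrMr//; lra.
have := H1 ps hps v0; have := H2 ps hps v0; have := small _ M1; have := small _ M2.
set E1 := pb_mean _ _ => k1 k2 h2; set E2 := pb_mean _ _ => h1.
have up : pb_cdf ps x <= E2.
  apply: pb_mean_le => // k; set w := _ / _.
  have /andP[r0 r1] := ramp01 x (x + d / 2) w.
  by case: (leP w x) => // wx; rewrite ramp_left.
have lo : E1 <= pb_cdf ps x.
  apply: pb_mean_le => // k; set w := (_ - _) / _.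
  have /andP[r0 r1] := ramp01 (x - d / 2) x w.
  by case: (leP w x) => // wx; rewrite ramp_right ?(ltW wx).
have n1 := near_x (x + d / 2); have n2 := near_x (x - d / 2).
have {}n1 : `|normal_cdf x - normal_cdf (x + d / 2)| < e / 2.
  by apply: n1; rewrite opprD addrA subrr add0r normrN gtr0_norm//; lra.
have {}n2 : `|normal_cdf x - normal_cdf (x - d / 2)| < e / 2.
  by apply: n2; rewrite opprB addrC subrK gtr0_norm//; lra.
move: n1 n2 h1 h2; rewrite !ltr_norml !ler_norml.
move=> /andP[? ?] /andP[? ?] /andP[? ?] /andP[? ?]; apply/andP; split; lra.
Qed.

End PoissonBinomialCLT.

(** * The number of block pairs *)

Section Uniform.
Variables (R : realType) (n : nat).

(** Expand g as a finite combination of indicators of points. *)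
Lemma expectation_unif_B0 (g : B0_partition n -> R) :
  ('E_(unif_B0 R n)[g] = ((\sum_p g p) / #|{: B0_partition n}|%:R)%:E)%E.
Proof.
rewrite unlock.
have mA (A : set (B0_partition n)) : measurable A by [].
have -> : (fun w => (g w)%:E) =
    (fun w => \sum_(p : B0_partition n) ((g p)%:E * (\1_[set p] w)%:E)%E)%E.
  apply/funext => w; rewrite (bigD1 w)//= indicE mem_set// mule1 big1 ?adde0// => p pw.
  by rewrite indicE memNset ?mule0//= => wp; rewrite wp eqxx in pw.
rewrite integral_sum//; last first.
  by move=> p; apply: integrableZl => //; exact: integrable_indic.
rewrite mulr_suml -sumEFin; apply: eq_bigr => p _.
rewrite integralZl//; last exact: integrable_indic.
rewrite integral_indic// setIT EFinM; congr (_ * _)%E.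
apply: (etrans (unif_B0E R [set p])).
rewrite (_ : [set q | q \in [set p]%classic]%SET = [set p]%SET).
  by rewrite finset.cards1 mul1r.
apply/finset.setP => q; rewrite finset.in_set finset.in_set1.
by apply/idP/eqP => [/set_mem|->]; rewrite ?inE.
Qed.

Lemma mean_block_pairs : exists ps : seq R,
  [/\ all (@is_proba R) ps, touchard_spread 2^-1 n = pb_var ps + 2^-1 &
      forall f, (\sum_(p : B0_partition n) f #|block_pairs (val p)|)
        / #|{: B0_partition n}|%:R = pb_mean ps f].
Proof.
have h0 : 0 < 2^-1 :> R by rewrite invr_gt0.
have [ps [hps E _ vE _]] := ratio_pb h0 n.
exists ps; split=> // f.
have -> : #|{: B0_partition n}|%:R = 2 ^+ n * touchard_value (2^-1 : R) n.
  by rewrite -(sum_B0_partition n (fun=> 1)) sumr_const.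
rewrite sum_B0_partition E; field.
by rewrite expf_neq0 ?pnatr_eq0 // andbT gt_eqF ?phi_gt0.
Qed.

Lemma xi'_poisson_binomial : exists ps : seq R,
  [/\ all (@is_proba R) ps, touchard_spread 2^-1 n = pb_var ps + 2^-1,
      ('V_(unif_B0 R n)[xi' R n] = (pb_var ps)%:E)%E &
      forall x, cdf (standardize (xi' R n) : {RV (unif_B0 R n) >-> R}) x = (pb_cdf ps x)%:E].
Proof.
have [ps [hps vE mE]] := mean_block_pairs; exists ps.
have EX : ('E_(unif_B0 R n)[xi' R n] = (pb_mu ps)%:E)%E.
  by rewrite expectation_unif_B0 (mE (fun k => k%:R)) pb_mean_id.
have VX : ('V_(unif_B0 R n)[xi' R n] = (pb_var ps)%:E)%E.
  rewrite /variance covariance.unlock EX /= expectation_unif_B0.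
  rewrite (mE (fun k => (k%:R - pb_mu ps) * (k%:R - pb_mu ps))).
  by rewrite -(pb_mean_variance ps).
split => // x.
rewrite /cdf /distribution /pushforward /= unif_B0E; congr EFin.
rewrite /pb_cdf -mE; congr (_ / _).
rewrite -sum1_card natr_sum big_mkcond /=; apply: eq_bigr => p _.
rewrite finset.in_set.
have -> : (p \in standardize (xi' R n) @^-1` `]-oo, x]) =
   (((#|block_pairs (val p)|%:R - pb_mu ps) / Num.sqrt (pb_var ps)) <= x).
  apply/idP/idP => [/set_mem|h]; first by rewrite /= in_itv /= /standardize EX VX.
  by apply/mem_set; rewrite /= in_itv /= /standardize EX VX.
by case: ifP.
Qed.

End Uniform.

Theorem theorem3p8 (R : realType) :
  (\forall n \near \oo, (0 < 'V_(unif_B0 R n)[xi' R n])%E) /\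
  cvg_in_distribution (fun n => standardize (xi' R n) : {RV (unif_B0 R n) >-> R})
    (normal_prob 0 1).
Proof.
have h0 : 0 < 2^-1 :> R by rewrite invr_gt0.
have large (B : R) : \forall n \near \oo, B <= touchard_spread (2^-1 : R) n.
  have [N HN] := spread_unbounded h0 B.
  by near=> n; apply: HN; near: n; exact: nbhs_infty_ger.
split.
  near=> n; have [ps [_ vE -> _]] := xi'_poisson_binomial R n; rewrite lte_fin.
  have : 1 <= touchard_spread (2^-1 : R) n by near: n; exact: large.
  by rewrite vE; lra.
move=> x _.
rewrite [X in _ --> X](_ : _ = (normal_cdf x)%:E); last by rewrite /normal_cdf fineK// fin_num_measure.
apply: cvg_EFin.
  near=> n; have [ps [_ _ _ ->]] := xi'_poisson_binomial R n; by [].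
apply/cvgrPdist_le => e e0; have [B HB] := pb_clt x e0.
near=> n; have [ps [hps vE _ cE]] := xi'_poisson_binomial R n.
rewrite /comp cE /=; apply: HB => //.
have : B + 2^-1 <= touchard_spread (2^-1 : R) n by near: n; exact: large.
by rewrite vE lerD2r.
Unshelve. all: by end_near. Qed.
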